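(* Fix $\kappa\ge 0$ and let $\alpha_c(\kappa)=\frac{2}{\pi C_\kappa}$. If $\alpha\in(0,\alpha_c(\kappa))$, then there exists a unique pair $(q,r)\in[0,1)\times[0,\infty)$ such that $$q=P(r),\qquad r=R_\kappa(q,\alpha).$$ Moreover, if $\alpha\ge\alpha_c(\kappa)$, then there is no pair $(q,r)\in[0,1)\times[0,\infty)$ satisfying these two equations.
   Context: Let $Z\sim\mathcal N(0,1)$ be a standard normal random variable, $\phi(u)=\frac{1}{\sqrt{2\pi}}e^{-u^2/2}$, $\Phi(u)=\int_{-\infty}^u\phi(s)\,ds$, $\overline{\Phi}(u)=1-\Phi(u)$, and $(x)_+=\max\{x,0\}$. Define $E(u)=\phi(u)/\overline{\Phi}(u)$ for $u\in\mathbb R$ (the inverse Mills ratio; $\mathbb E$ denotes expectation). For $q\in[0,1)$ and $x\in\mathbb R$ set $$F_q(x)=\frac{1}{\sqrt{1-q}}\,E\!\left(\frac{\kappa-x}{\sqrt{1-q}}\right).$$ For $r\ge 0$ set $P(r)=\mathbb E[\tanh^2(\sqrt r\,Z)]$. For $\alpha>0$, $\kappa\ge0$, $q\in[0,1)$ set $R_\kappa(q,\alpha)=\alpha\,\mathbb E[F_q(\sqrt q\,Z)^2]$. Finally $C_\kappa=\mathbb E[(\kappa-Z)_+^2]=(\kappa^2+1)\Phi(\kappa)+\kappa\phi(\kappa)$. *)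

(* Defs.v *)
From HB Require Import structures.
From mathcomp Require Import all_boot all_order all_algebra.
From mathcomp Require Import all_classical all_reals all_analysis.

Set Implicit Arguments.
Unset Strict Implicit.
Unset Printing Implicit Defensive.

Import Order.TTheory GRing.Theory Num.Theory.
Import numFieldNormedType.Exports.

Local Open Scope classical_set_scope.
Local Open Scope ring_scope.

Section defs.
Context {R : realType}.
Implicit Types kappa alpha q r u x : R.

Definition phi u : R := (Num.sqrt (2 * pi))^-1 * expR (- (u ^+ 2) / 2).

Lemma phiE : phi = normal_pdf 0 1.
Proof.
apply/funext => u; rewrite normal_pdfE ?oner_neq0// /phi /normal_peak /normal_fun.
by rewrite subr0 expr1n mul1r mulr_natl.
Qed.

Definition Phi u : R := \int[lebesgue_measure]_(s in `]-oo, u]) phi s.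

Definition Phibar u : R := 1 - Phi u.

Definition tanh x : R := (expR x - expR (- x)) / (expR x + expR (- x)).

(* Expectation of f(Z) for Z standard normal. [fine] sends infinite values to 0,
   but it is only applied below to integrands with finite expectation: tanh^2 is
   bounded, and the other two grow at most quadratically, since the inverse Mills
   ratio grows at most linearly. *)
Definition gaussE (f : R -> R) : R := fine ('E_(normal_prob 0 1)[f])%E.

Definition invMills u : R := phi u / Phibar u.

Definition F_q kappa q x : R :=
  (Num.sqrt (1 - q))^-1 * invMills ((kappa - x) / Num.sqrt (1 - q)).

Definition P_r r : R := gaussE (fun z => tanh (Num.sqrt r * z) ^+ 2).

Definition R_kappa kappa q alpha : R :=
  alpha * gaussE (fun z => F_q kappa q (Num.sqrt q * z) ^+ 2).

Definition C_kappa kappa : R := gaussE (fun z => Num.max (kappa - z) 0 ^+ 2).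

Definition alpha_c kappa : R := 2 / (pi * C_kappa kappa).

Definition solution kappa alpha q r : Prop :=
  [/\ 0 <= q < 1, 0 <= r, q = P_r r & r = R_kappa kappa q alpha].

End defs.

(* Main.v *)
From HB Require Import structures.
Require Import Defs.
From mathcomp Require Import all_boot all_order all_algebra.
From mathcomp Require Import ring lra.
From mathcomp Require Import all_classical all_reals all_analysis.
From mathcomp Require Import measurable_realfun.

Set Implicit Arguments.
Unset Strict Implicit.
Unset Printing Implicit Defensive.

Import Order.TTheory GRing.Theory Num.Theory.
Import numFieldNormedType.Exports.

Local Open Scope classical_set_scope.
Local Open Scope ring_scope.

(** Put [s = sqrt r] and [q(s) = E tanh(s Z)^2]. The first equation says
    [q = q(s)], and the second becomes
      [(s (1 - q(s)))^2 = alpha H(q(s))], where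
      [H(q) = (1 - q)^2 E F_q(sqrt q Z)^2].
    The left side is strictly increasing in [s], the right side is nonincreasing,
    and both are continuous; so there is at most one solution, and there is one
    exactly when the left side overtakes the right side at infinity.

    Left side. Gaussian integration by parts gives
    [s (1 - q(s)) = E (Z tanh(s Z))] ([overlap_moment]), whose integrand increases
    to [|Z|]; so its square increases strictly from [0] to [(E |Z|)^2 = 2 / pi].

    Right side. Let [e = phi / Phibar], so that [e' = e (e - u)], and
    [a = sqrt (q / (1 - q))], [U = kappa sqrt (a^2 + 1) - a Z]. Then
    [H = E e(U)^2 / (a^2 + 1)], and a second integration by parts
    ([has_deriv_energy]) shows that for [a > 0] the sign of [dH/da] is that of
    [E D(U)], where
      [D(u) = e^2 ((e - u)^2 + 2 e (e - u) - 2)].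
    The function [D] takes both signs, but [D <= -1/20] on the right half line and
    [D <= 1/20] on the left one. As [kappa >= 0], for any two opposite values of
    [Z] one of the two values of [U] is nonnegative; hence [E D(U) <= 0]
    ([mean_drift_le0]). Since [u_+ <= e(u) <= u_+ + 1], [H] tends to
    [C_kappa] as [q] tends to [1] ([energy_limit]). So [alpha H] stays above
    [alpha C_kappa] and tends to it, and the limits of the two sides compare as
    [2 / pi] and [alpha C_kappa], which is the comparison of [alpha_c] and [alpha].

    Bounds on [D]. On the right, the bound
    [2 e (e - u) + (pi - 2) (e - u)^2 <= 2], equivalent to one of Boyd
    ([invMills_boyd]), gives [D <= - (pi - 3) (e')^2], and [e' >= 2 / pi] there
    ([invMills_slope_ge]); both come from one comparison principle for
    [e' = e (e - u)] ([ge0_unimodal]), and a lower bound on [pi] closes the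
    argument. On the left, [D] vanishes at infinity, and its values at critical
    points satisfy an algebraic relation that keeps them below [1/20]
    ([drift_critical]). *)

(** * Derivatives of real functions *)

Section calculus.
Context {R : realType}.
Implicit Types (f g : R -> R) (x a b c : R).

(** [is_derive] is a type class, whose instances are resolved as soon as a rule
    is applied; this plain copy leaves the choice of the rule to the proof and
    keeps the value of the derivative in the form the rule gives to it. *)
Definition has_deriv f x a : Prop := is_derive x 1 f a.

Lemma has_deriv_eq f x a b : has_deriv f x a -> a = b -> has_deriv f x b.
Proof. by move=> ? <-. Qed.

Lemma has_deriv_cst c x : has_deriv (fun=> c) x 0.
Proof. exact: is_derive_cst. Qed.

Lemma has_deriv_id x : has_deriv (fun y => y) x 1.
Proof. exact: is_derive_id. Qed.

Lemma has_derivD f g x a b : has_deriv f x a -> has_deriv g x b ->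
  has_deriv (fun y => f y + g y) x (a + b).
Proof. exact: is_deriveD. Qed.

Lemma has_derivN f x a : has_deriv f x a -> has_deriv (fun y => - f y) x (- a).
Proof. exact: is_deriveN. Qed.

Lemma has_derivB f g x a b : has_deriv f x a -> has_deriv g x b ->
  has_deriv (fun y => f y - g y) x (a - b).
Proof. exact: is_deriveB. Qed.

Lemma has_derivM f g x a b : has_deriv f x a -> has_deriv g x b ->
  has_deriv (fun y => f y * g y) x (a * g x + f x * b).
Proof.
move=> fa gb; apply: has_deriv_eq; first exact: (is_deriveM fa gb).
by rewrite addrC /GRing.scale /= [g x * a]mulrC.
Qed.

Lemma has_derivZ f c x a : has_deriv f x a ->
  has_deriv (fun y => c * f y) x (c * a).
Proof.
move=> fa; apply: has_deriv_eq; first exact: (has_derivM (has_deriv_cst c x) fa).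
by rewrite mul0r add0r.
Qed.

Lemma has_deriv_sqr f x a : has_deriv f x a ->
  has_deriv (fun y => f y ^+ 2) x (2 * f x * a).
Proof.
move=> fa; apply: has_deriv_eq; first exact: (has_derivM fa fa).
by ring.
Qed.

Lemma has_deriv_div f g x a b : g x != 0 ->
  has_deriv f x a -> has_deriv g x b ->
  has_deriv (fun y => f y / g y) x ((a * g x - f x * b) / g x ^+ 2).
Proof.
move=> gx0 fa gb; apply: has_deriv_eq.
  by apply: has_derivM; [exact: fa|exact: (is_deriveV gx0 gb)].
by rewrite /GRing.scale /=; field.
Qed.

Lemma has_deriv_comp f g x a b : has_deriv f (g x) a ->
  has_deriv g x b -> has_deriv (fun y => f (g y)) x (a * b).
Proof. exact: is_derive1_comp. Qed.

Lemma has_deriv_exp f x a : has_deriv f x a ->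
  has_deriv (fun y => expR (f y)) x (expR (f x) * a).
Proof. exact: has_deriv_comp (is_derive_expR _). Qed.

Lemma has_deriv_sqrt f x a : 0 < f x -> has_deriv f x a ->
  has_deriv (fun y => Num.sqrt (f y)) x (a / (2 * Num.sqrt (f x))).
Proof.
move=> fx0 fa; apply: has_deriv_eq.
  exact: (has_deriv_comp (is_derive1_sqrt fx0) fa).
by rewrite mulrC.
Qed.

Lemma has_deriv_continuous f x a : has_deriv f x a -> {for x, continuous f}.
Proof. by move=> [+ _] => /derivable1_diffP/differentiable_continuous. Qed.

Lemma nondecreasing_derive f f' a b : a <= b ->
  (forall x, a <= x <= b -> has_deriv f x (f' x)) ->
  (forall x, a <= x <= b -> 0 <= f' x) -> f a <= f b.
Proof.
move=> ab df f0.
have [||c cab E] := MVT_segment ab (f := f) (df := f').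
- by move=> x; rewrite in_itv /= => /andP[/ltW ? /ltW ?]; apply/df/andP.
- apply: derivable_within_continuous => x; rewrite in_itv /= => xab.
  by have [] := df _ xab.
by rewrite -subr_ge0 E mulr_ge0 ?subr_ge0// f0 // -in_itv.
Qed.

Lemma increasing_derive f f' a b : a < b ->
  (forall x, a <= x <= b -> has_deriv f x (f' x)) ->
  (forall x, a < x < b -> 0 < f' x) -> f a < f b.
Proof.
move=> ab df f0.
have [||c cab E] := MVT ab (f := f) (df := f').
- by move=> x; rewrite in_itv /= => /andP[/ltW ? /ltW ?]; apply/df/andP.
- apply: derivable_within_continuous => x; rewrite in_itv /= => xab.
  by have [] := df _ xab.
by rewrite -subr_gt0 E mulr_gt0 ?subr_gt0// f0 // -in_itv.
Qed.

End calculus.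

(** * Gaussian expectations *)

Section gauss.
Context {R : realType}.
Implicit Types (f g : R -> R) (c x y z K : R).
Local Notation mu := (@lebesgue_measure R).
Local Notation gam := (@normal_prob R 0 1).

Lemma phi_gt0 x : 0 < phi x.
Proof. by rewrite mulr_gt0 ?expR_gt0 // invr_gt0 sqrtr_gt0 mulr_gt0 ?pi_gt0. Qed.

Lemma phiN x : phi (- x) = phi x.
Proof. by rewrite /phi sqrrN. Qed.

Lemma continuous_phi : continuous (@phi R).
Proof. by rewrite phiE; apply: continuous_normal_pdf; rewrite oner_neq0. Qed.

Lemma has_deriv_phi x : has_deriv phi x (- x * phi x).
Proof.
apply: has_deriv_eq.
  apply/has_derivZ/has_deriv_exp.
  apply: has_derivM (has_deriv_cst _ _).
  exact/has_derivN/has_deriv_sqr/has_deriv_id.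
by rewrite /phi; field; rewrite gt_eqF // sqrtr_gt0 mulr_gt0 ?pi_gt0.
Qed.

(** Quadratic growth is what the squared inverse Mills ratio requires; continuity
    gives measurability and access to the fundamental theorem of calculus. *)
Definition quad_growth f :=
  continuous f /\ exists K, forall z, `|f z| <= K * (1 + z ^+ 2).

Lemma quad_growthD f g : quad_growth f -> quad_growth g ->
  quad_growth (fun z => f z + g z).
Proof.
move=> [cf [K fK]] [cg [L gL]]; split.
  by move=> z; apply: cvgD; [exact: cf|exact: cg].
exists (K + L) => z; rewrite mulrDl.
by apply: le_trans (ler_normD _ _) _; exact: lerD.
Qed.

Lemma quad_growthZ c f : quad_growth f -> quad_growth (fun z => c * f z).
Proof.
move=> [cf [K fK]]; split; first by move=> z; apply: cvgM; [exact: cvg_cst|exact: cf].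
by exists (`|c| * K) => z; rewrite normrM -mulrA ler_wpM2l.
Qed.

Lemma quad_growthB f g : quad_growth f -> quad_growth g ->
  quad_growth (fun z => f z - g z).
Proof.
move=> qf /(quad_growthZ (-1)) /(quad_growthD qf).
by under eq_fun do rewrite mulN1r.
Qed.

Lemma quad_growth_1sqr : quad_growth (fun z => 1 + z ^+ 2).
Proof.
split; last by exists 1 => z; rewrite mul1r ger0_norm // addr_ge0 // sqr_ge0.
by move=> z; apply: cvgD; [exact: cvg_cst|exact: exprn_continuous].
Qed.

Lemma measurable_quad_growth f : quad_growth f -> measurable_fun setT f.
Proof. by case=> cf _; exact: continuous_measurable_fun. Qed.

Lemma measurable_phi : measurable_fun setT (@phi R).
Proof. exact: continuous_measurable_fun continuous_phi. Qed.

(** Half of the exponent of [phi] absorbs the quadratic factor; the other half is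
    a Gaussian density of variance [2], so integrability needs no computation of
    moments. *)
Lemma sqr_phi_le_normal_pdf z :
  (1 + z ^+ 2) * phi z <= 4 * Num.sqrt 2 * normal_pdf 0 (Num.sqrt 2) z.
Proof.
have s2 : Num.sqrt (2:R) != 0 by rewrite gt_eqF // sqrtr_gt0.
have pi0 := @pi_gt0 R.
rewrite normal_pdfE // /normal_peak /normal_fun subr0 sqr_sqrtr // /phi.
have -> : (2 * pi *+ 2) = 2 * (2 * pi) :> R by ring.
rewrite [X in _ <= _ * (X^-1 * _)]sqrtrM // invfM.
have -> : - z ^+ 2 / 2 = - z ^+ 2 / (2 *+ 2) + - z ^+ 2 / (2 *+ 2) by field.
rewrite expRD.
set c := (Num.sqrt (2 * pi))^-1; set e := expR _.
have -> : 4 * Num.sqrt 2 * ((Num.sqrt 2)^-1 * c * e) = 4 * c * e.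
  by rewrite !mulrA -(mulrA 4) divff // mulr1.
have c0 : 0 < c by rewrite invr_gt0 sqrtr_gt0 mulr_gt0.
have e0 : 0 < e by exact: expR_gt0.
have le1 : (1 + z ^+ 2 / 4) * e <= 1.
  rewrite /e mulNr expRN ler_pdivrMr ?expR_gt0 // mul1r.
  have -> : 2 *+ 2 = 4 :> R by ring.
  exact: expR_ge1Dx.
have z2 := sqr_ge0 z.
rewrite (_ : _ * _ = (1 + z ^+ 2) * e * (c * e)); last by ring.
rewrite -(mulrA 4) ler_wpM2r ?mulr_ge0 ?(ltW c0) ?(ltW e0) //.
by nra.
Qed.

Lemma integrable_mul_phi f : quad_growth f ->
  mu.-integrable setT (fun z => (f z * phi z)%:E).
Proof.
move=> qf; have [_ [K fK]] := qf.
have s2 : Num.sqrt (2:R) != 0 by rewrite gt_eqF // sqrtr_gt0.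
have K0 : 0 <= K by have := fK 0; rewrite expr0n addr0 mulr1; apply: le_trans.
have := integrableZl measurableT (K * (4 * Num.sqrt 2))
  (integrable_normal_pdf 0 (Num.sqrt 2)).
apply: le_integrable => //.
  apply/measurable_EFinP/measurable_funM; last exact: measurable_phi.
  exact: measurable_quad_growth.
move=> z _; rewrite -EFinM !abse_EFin lee_fin.
have pz : 0 <= phi (z : R) by exact/ltW/phi_gt0.
rewrite (normrM (f z)) (ger0_norm pz) [leRHS]ger0_norm; last first.
  by rewrite !mulr_ge0 // normal_pdf_ge0.
apply: (le_trans (ler_wpM2r pz (fK z))).
by rewrite -!(mulrA K) ler_wpM2l // sqr_phi_le_normal_pdf.
Qed.

(** The Gaussian law is given as a set function; that its integral is the one
    against its density follows from uniqueness of the Radon-Nikodym derivative. *)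
Lemma ge0_integral_gauss f : measurable_fun setT f -> (forall z, 0 <= f z) ->
  (\int[gam]_z (f z)%:E = \int[mu]_z (f z * phi z)%:E)%E.
Proof.
move=> mf f0; have dom := @normal_prob_dominates R 0 1.
rewrite -(Radon_Nikodym_SigmaFinite.change_of_variables dom) //=; last first.
  exact/measurable_EFinP.
have iRN := Radon_Nikodym_SigmaFinite.f_integrable dom.
apply: ae_eq_integral => //=.
- apply: emeasurable_funM; first exact/measurable_EFinP.
  exact: (measurable_int mu iRN).
- by apply/measurable_EFinP/measurable_funM => //; exact: measurable_phi.
under [X in ae_eq _ _ _ X]eq_fun do rewrite EFinM.
apply: ae_eqe_mul2l; apply: integral_ae_eq => //.
- by apply/measurable_EFinP; exact: measurable_phi.
- move=> A ? mA.
  rewrite -(Radon_Nikodym_SigmaFinite.f_integral dom) // /normal_prob.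
  by rewrite phiE.
Qed.

Lemma integrable_gauss f : quad_growth f -> gam.-integrable setT (EFin \o f).
Proof.
move=> qf; have mf := measurable_quad_growth qf.
apply/integrableP; split; first exact/measurable_EFinP.
rewrite ge0_integral_gauss //; last exact: measurableT_comp.
have /integrableP[_] := integrable_mul_phi qf.
by under eq_integral do rewrite /= normrM (gtr0_norm (phi_gt0 _)).
Qed.

Lemma gaussE_Rintegral f : gaussE f = \int[gam]_z f z.
Proof. by rewrite /gaussE unlock. Qed.

Lemma gaussED f g : quad_growth f -> quad_growth g ->
  gaussE (fun z => f z + g z) = gaussE f + gaussE g.
Proof.
by move=> *; rewrite !gaussE_Rintegral RintegralD //; exact: integrable_gauss.
Qed.

Lemma gaussEB f g : quad_growth f -> quad_growth g ->
  gaussE (fun z => f z - g z) = gaussE f - gaussE g.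
Proof.
by move=> *; rewrite !gaussE_Rintegral RintegralB //; exact: integrable_gauss.
Qed.

Lemma gaussEZ c f : quad_growth f -> gaussE (fun z => c * f z) = c * gaussE f.
Proof.
by move=> *; rewrite !gaussE_Rintegral RintegralZl //; exact: integrable_gauss.
Qed.

Lemma gaussE_cst c : gaussE (fun=> c) = c.
Proof.
rewrite gaussE_Rintegral Rintegral_cst //.
rewrite [X in fine X](_ : _ = 1%E) ?mulr1 //; exact: (probability_setT gam).
Qed.

Lemma le_gaussE f g : quad_growth f -> quad_growth g ->
  (forall z, f z <= g z) -> gaussE f <= gaussE g.
Proof.
by move=> *; rewrite !gaussE_Rintegral le_Rintegral //; exact: integrable_gauss.
Qed.

(** The form of the expectation to which calculus on the line applies. *)
Lemma gaussE_density f : quad_growth f -> gaussE f = \int[mu]_z (f z * phi z).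
Proof.
move=> qf; have [cf [K fK]] := qf.
(* Adding [K (1 + z^2)] reduces to a nonnegative integrand. *)
have qK : quad_growth (fun z => K * (1 + z ^+ 2)).
  exact/quad_growthZ/quad_growth_1sqr.
have qfK : quad_growth (fun z => f z + K * (1 + z ^+ 2)) by exact: quad_growthD.
have ge0 g : quad_growth g -> (forall z, 0 <= g z) ->
    gaussE g = \int[mu]_z (g z * phi z).
  move=> qg g0; rewrite gaussE_Rintegral /Rintegral ge0_integral_gauss //.
  exact: measurable_quad_growth.
have fE : f = (fun z => (f z + K * (1 + z ^+ 2)) - K * (1 + z ^+ 2)).
  by apply/funext => z; rewrite addrK.
rewrite {1}fE gaussEB // !ge0 //.
- rewrite -RintegralB //; [|exact: integrable_mul_phi..].
  by apply: eq_Rintegral => z _; ring.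
- by move=> z; apply: (le_trans _ (fK z)).
- by move=> z; rewrite -lerBlDr sub0r lerNl (le_trans _ (fK z)) // -normrN ler_norm.
Qed.

(** Whole-line integrals are reached from symmetric segments, where the
    fundamental theorem and the reflection [z -> -z] are available for integrands
    of arbitrary sign. *)
Lemma cvg_Rintegral_centered g : mu.-integrable setT (EFin \o g) ->
  \int[mu]_(z in `[- n%:R, n%:R]) g z @[n --> \oo] --> \int[mu]_z g z.
Proof.
move=> ig; apply: fine_cvg; rewrite fineK; last exact: integrable_fin_num.
under eq_fun do rewrite integral_mkcond.
apply: (@dominated_cvg _ _ _ mu setT measurableT _ _ (fun z => abse (g z)%:E)) => //.
- move=> n; apply/(measurable_restrictT _ _).1 => //.
  by apply: (measurable_funS measurableT) => //; exact: (measurable_int mu ig).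
- move=> z _; apply: (@cvg_near_cst _ _ _ _ _ _) => //.
  near=> n; rewrite patchE mem_set //= in_itv /= -ler_norml.
  by near: n; exact: nbhs_infty_ger.
- exact: integrable_abse.
- move=> n z _; rewrite patchE; case: ifP => // _.
  by rewrite abse0 abse_ge0.
Unshelve. all: by end_near. Qed.

Lemma Rintegral_has_deriv (F g : R -> R) a b : a < b ->
  (forall x, a <= x <= b -> has_deriv F x (g x)) ->
  {within `[a, b], continuous g} ->
  \int[mu]_(z in `[a, b]) g z = F b - F a.
Proof.
move=> ab dF cg; rewrite /Rintegral (@continuous_FTC2 _ _ F) //.
- split.
  + move=> x; rewrite in_itv /= => /andP[/ltW ? /ltW ?].
    by case: (dF x _) => //; exact/andP.
  + apply: cvg_at_right_filter; apply: has_deriv_continuous (dF _ _).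
    by rewrite lexx ltW.
  + apply: cvg_at_left_filter; apply: has_deriv_continuous (dF _ _).
    by rewrite lexx ltW.
- move=> x; rewrite in_itv /= => /andP[/ltW ? /ltW ?]; rewrite derive1E.
  by case: (dF x _) => //; exact/andP.
Qed.

Lemma cvgn_unique (u : nat -> R) x y :
  u n @[n --> \oo] --> x -> u n @[n --> \oo] --> y -> x = y.
Proof. by move=> /cvg_lim <- // /cvg_lim <-. Qed.

Lemma Rintegral_deriv_vanishing (F g : R -> R) :
  (forall x, has_deriv F x (g x)) -> continuous g ->
  mu.-integrable setT (EFin \o g) ->
  F n%:R @[n --> \oo] --> (0 : R) -> F (- n%:R) @[n --> \oo] --> (0 : R) ->
  \int[mu]_z g z = 0.
Proof.
move=> dF cg ig Fy FNy.
apply: (cvgn_unique (cvg_Rintegral_centered ig)).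
have : F n%:R - F (- n%:R) @[n --> \oo] --> (0 : R).
  by rewrite -[X in _ --> X](subr0 0); exact: cvgB.
apply: cvg_trans; apply: near_eq_cvg; near=> n.
rewrite (@Rintegral_has_deriv F) //.
- have : (0 < n)%N by near: n; exact: nbhs_infty_gt.
  by rewrite -(ltr_nat R) => ?; rewrite gtrN.
- exact: continuous_subspaceT.
Unshelve. all: by end_near. Qed.

(** From [1 + y <= exp y] at [y = x^2 / 4], squared. *)
Lemma phi_decay x : x ^+ 2 * ((1 + x ^+ 2) * phi x) <= 16.
Proof.
have pi0 := @pi_gt0 R; have pi2 := @pi_ge2 R.
have c0 : 0 < (Num.sqrt (2 * pi) : R) by rewrite sqrtr_gt0 mulr_gt0.
have c1 : (Num.sqrt (2 * pi))^-1 <= 1 :> R.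
  rewrite invf_le1 // -[leLHS]sqrtr1 ler_wsqrtr //; lra.
rewrite /phi; set c := _^-1 in c1 *.
have -> : - x ^+ 2 / 2 = - (x ^+ 2 / 4) - x ^+ 2 / 4 by field.
rewrite expRD expRN.
have := expR_ge1Dx (x ^+ 2 / 4); set e := expR _ => le.
have x0 := sqr_ge0 x; set y := x ^+ 2 in x0 le *.
have e0 : 0 < e by lra.
have ci0 : 0 < c by rewrite invr_gt0.
have -> : y * ((1 + y) * (c * (e^-1 / e))) = c * (y * (1 + y)) / e ^+ 2.
  by field; rewrite gt_eqF.
rewrite ler_pdivrMr ?exprn_gt0 //.
apply: (@le_trans _ _ (1 * (y * (1 + y)))).
  by rewrite ler_wpM2r // mulr_ge0 // addr_ge0.
by rewrite mul1r; nra.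
Qed.

Lemma cvgy_phi : phi x @[x --> +oo] --> (0 : R).
Proof.
rewrite /phi -[X in _ --> X](mulr0 (Num.sqrt (2 * pi))^-1).
apply: cvgM; first exact: cvg_cst.
under eq_fun do rewrite mulNr.
apply: (cvg_comp (fun x => x ^+ 2 / 2) (fun x => expR (- x))); last exact: cvgr_expR.
by apply: gt0_cvgMly => //; exact: cvgr_expr2.
Qed.

Lemma cvg_quad_growth_phi f (u : nat -> R) : quad_growth f ->
  (forall n, `|u n| = n%:R) -> f (u n) * phi (u n) @[n --> \oo] --> (0 : R).
Proof.
move=> [_ [K fK]] un.
have K0 : 0 <= K by have := fK 0; rewrite expr0n addr0 mulr1; apply: le_trans.
apply: norm_cvg0.
apply: (@squeeze_cvgr _ _ _ _ (cst 0) (fun n => 16 * K * n%:R^-1)).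
- near=> n; rewrite /= normr_ge0 /= normrM (gtr0_norm (phi_gt0 _)).
  have n1 : 1 <= n%:R :> R.
    by rewrite (ler_nat _ 1); near: n; exact: nbhs_infty_gt.
  have n0 : 0 < n%:R :> R by apply: lt_le_trans n1.
  apply: (le_trans (ler_wpM2r (ltW (phi_gt0 _)) (fK _))).
  rewrite ler_pdivlMr //.
  have := phi_decay (u n); rewrite -(real_normK (num_real (u n))) un.
  have := phi_gt0 (u n); set p := phi _ => p0.
  set m := n%:R in n0 n1 *; move=> h.
  have : (1 + m ^+ 2) * p * m <= m ^+ 2 * ((1 + m ^+ 2) * p).
    rewrite [leRHS]mulrC ler_wpM2l ?mulr_ge0 ?(ltW p0) ?addr_ge0 ?sqr_ge0 //.
    by nra.
  by nra.
- exact: cvg_cst.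
- rewrite -[X in _ --> X](mulr0 (16 * K)); apply: cvgM; first exact: cvg_cst.
  apply/gtr0_cvgV0; last exact: cvgr_idn.
  by near=> n; rewrite ltr0n; near: n; exact: nbhs_infty_gt.
Unshelve. all: by end_near. Qed.

(** Stein's lemma: [(f phi)' = (f' - z f) phi] integrates to [0]. *)
Lemma gaussE_stein f f' : (forall x, has_deriv f x (f' x)) ->
  quad_growth f -> quad_growth f' -> quad_growth (fun z => z * f z) ->
  gaussE (fun z => z * f z) = gaussE f'.
Proof.
move=> df qf qf' qzf; apply/eqP; rewrite eq_sym -subr_eq0 -gaussEB //.
have qd := quad_growthB qf' qzf.
rewrite gaussE_density //; apply/eqP.
apply: (@Rintegral_deriv_vanishing (fun z => f z * phi z)).
- move=> x; apply: has_deriv_eq; first exact: has_derivM (df x) (has_deriv_phi x).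
  by ring.
- by move=> x; apply: cvgM; [case: qd => + _; exact|exact: continuous_phi].
- exact: integrable_mul_phi.
- by apply: cvg_quad_growth_phi => // n; rewrite ger0_norm.
- by apply: cvg_quad_growth_phi => // n; rewrite normrN ger0_norm.
Qed.

Lemma gaussE_opp f : quad_growth f -> gaussE (fun z => f (- z)) = gaussE f.
Proof.
move=> qf; have [cf [K fK]] := qf.
have qfN : quad_growth (fun z => f (- z)).
  split; last by exists K => z; rewrite -(sqrrN z).
  move=> z; apply: continuous_comp; last exact: cf.
  exact: opp_continuous.
rewrite !gaussE_density //.
have := cvg_Rintegral_centered (integrable_mul_phi qfN).
have := cvg_Rintegral_centered (integrable_mul_phi qf).
rewrite (_ : (fun n => _) =
  fun n => \int[mu]_(z in `[- n%:R, n%:R]) (f (- z) * phi z)).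
  by move=> h1 h2; exact: cvgn_unique h2 h1.
apply/funext => n; rewrite /Rintegral.
rewrite -[X in `[_, X]]opprK integration_by_substitution_oppr //.
- by rewrite opprK; apply: congr1; apply: eq_integral => z _; rewrite /= phiN.
- by rewrite (@le_trans _ _ 0) // oppr_le0.
- apply: continuous_subspaceT => z; apply: cvgM; first exact: cf.
  exact: continuous_phi.
Qed.

(** [z phi] has primitive [- phi]. *)
Lemma gaussE_norm : gaussE (fun z => `|z|) = 2 * phi 0.
Proof.
rewrite gaussE_density; last first.
  split; first exact: norm_continuous.
  exists 1 => z; rewrite normr_id mul1r -(real_normK (num_real z)).
  by have := sqr_ge0 (`|z| - 1); nra.
rewrite /Rintegral ge0_symfun_integralT; last 3 first.
- by move=> z; rewrite mulr_ge0 // ltW // phi_gt0.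
- by move=> z; apply: cvgM; [exact: norm_continuous|exact: continuous_phi].
- by move=> z; rewrite /= normrN phiN.
rewrite -set_itvcy.
rewrite (_ : integral _ _ _ =
    (\int[mu]_(z in `[0%R, +oo[) (z * phi z)%:E)%E); last first.
  apply: eq_integral => z; rewrite inE /= in_itv /= andbT => z0.
  by rewrite ger0_norm.
rewrite (@ge0_continuous_FTC2y _ _ (fun z => - phi z) _ 0).
- by rewrite -EFinB -EFinM /= sub0r opprK.
- by move=> x x0; rewrite mulr_ge0 // ltW // phi_gt0.
- apply: continuous_subspaceT => z.
  by apply: cvgM; [exact: cvg_id|exact: continuous_phi].
- by rewrite -oppr0; apply: cvgN; exact: cvgy_phi.
- by move=> x _; case: (has_derivN (has_deriv_phi x)).
- apply: cvg_at_right_filter.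
  exact: has_deriv_continuous (has_derivN (has_deriv_phi 0)).
- by move=> x _; rewrite derive1E; case: (has_derivN (has_deriv_phi x)) => _ ->; ring.
Qed.

(** [K (1 + z^2)] serves as dominating function. It is only asked for near the
    point of differentiation, since the growth constants depend on the parameter. *)
Lemma gaussE_has_deriv (f f' : R -> R -> R) a u v K : u < a < v ->
  (forall s, u < s < v -> quad_growth (f s)) ->
  (forall s z, u < s < v -> has_deriv (f ^~ z) s (f' s z)) ->
  (forall s z, u < s < v -> `|f' s z| <= K * (1 + z ^+ 2)) ->
  has_deriv (fun s => gaussE (f s)) a (gaussE (f' a)).
Proof.
move=> uav qf df f'K.
have K0 : 0 <= K by have := f'K a 0 uav; rewrite expr0n addr0 mulr1; apply: le_trans.
have Ia : `]u, v[%classic a by rewrite /= in_itv.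
have iK := integrable_gauss (quad_growthZ K quad_growth_1sqr).
have d1 s z : u < s < v -> partial1of2 f s z = f' s z.
  by move=> usv; rewrite partial1of2E; case: (df s z usv).
have intf s : `]u, v[%classic s -> gam.-integrable setT (EFin \o f s).
  by rewrite /= in_itv /= => /qf /integrable_gauss.
have derf s z : `]u, v[%classic s -> setT z -> derivable (f ^~ z) s 1.
  by rewrite /= in_itv /= => usv _; case: (df s z usv).
have f'ub s z : `]u, v[%classic s -> setT z -> `|partial1of2 f s z| <= K * (1 + z ^+ 2).
  by rewrite /= in_itv /= => usv _; rewrite d1 // f'K.
have K1 z : 0 <= K * (1 + z ^+ 2) by rewrite mulr_ge0 // addr_ge0 // sqr_ge0.
under eq_fun do rewrite gaussE_Rintegral.
split.
  exact: (derivable_under_integral measurableT Ia intf derf K1 iK f'ub).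
rewrite -derive1E.
rewrite (differentiation_under_integral measurableT Ia intf derf K1 iK f'ub).
by rewrite gaussE_Rintegral; apply: eq_Rintegral => z _; exact: d1.
Qed.

End gauss.

(** * The Gaussian tail and the inverse Mills ratio *)

Section tail.
Context {R : realType}.
Implicit Types (u x : R).
Local Notation mu := (@lebesgue_measure R).

Lemma integrable_phi : mu.-integrable setT (EFin \o @phi R).
Proof. by rewrite phiE; exact: integrable_normal_pdf. Qed.

Lemma Rintegral_phi : \int[mu]_z phi z = 1.
Proof. by rewrite /Rintegral phiE integral_normal_pdf. Qed.

Lemma has_deriv_Phi u : has_deriv Phi u (phi u).
Proof.
have [||||d e] := @continuous_FTC1 R phi -oo%O u (u + 1) => //.
- by rewrite ltrDl.
- exact: integrableS integrable_phi.
- by rewrite ltNyr.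
- exact: continuous_phi.
by split => //; rewrite -derive1E.
Qed.

(** By symmetry of [phi], half of the total mass [1]. *)
Lemma Phi0 : Phi 0 = 2^-1 :> R.
Proof.
have : (\int[mu]_z (phi z)%:E = 1)%E by rewrite phiE integral_normal_pdf.
rewrite ge0_symfun_integralT; last 3 first.
- by move=> z; rewrite ltW // phi_gt0.
- exact: continuous_phi.
- by move=> z; rewrite /= phiN.
rewrite -set_itvcy.
have : (\int[mu]_(x in `]-oo, (-0)%R]) (phi x)%:E =
        \int[mu]_(x in `[0%R, +oo[) (phi x)%:E)%E.
  rewrite ge0_integration_by_substitutionNy.
  - by apply: eq_integral => z _; rewrite /= phiN.
  - by apply: continuous_subspaceT; exact: continuous_phi.
  - by move=> z _; rewrite ltW // phi_gt0.
rewrite oppr0 => <-.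
have fin : (\int[mu]_(x in `]-oo, 0%R]) (phi x)%:E)%E \is a fin_num.
  by apply: integrable_fin_num => //; apply: integrableS integrable_phi.
rewrite /Phi /Rintegral -(fineK fin) -EFinM => -[] /=; set p := fine _; lra.
Qed.

Lemma Phi_le1 u : Phi u <= 1.
Proof.
rewrite -Rintegral_phi /Phi /Rintegral fine_le //.
- by apply: integrable_fin_num => //; apply: integrableS integrable_phi.
- by apply: integrable_fin_num => //; exact: integrable_phi.
- apply: ge0_subset_integral => //.
  + by apply/measurable_EFinP; exact: measurable_phi.
  + by move=> z _; rewrite lee_fin ltW // phi_gt0.
Qed.

Lemma cvg_Phibar : Phibar n%:R @[n --> \oo] --> (0 : R).
Proof.
have h : 1 - \int[mu]_(z in `[- n%:R, n%:R]) phi z @[n --> \oo] --> (0 : R).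
  rewrite -[X in _ --> X](subrr 1); apply: cvgB; first exact: cvg_cst.
  by rewrite -[X in _ --> X]Rintegral_phi; exact: cvg_Rintegral_centered integrable_phi.
apply: (@squeeze_cvgr _ _ _ _ (cst 0) _ _ _ _ _ h); last exact: cvg_cst.
near=> n; rewrite /= /Phibar subr_ge0 Phi_le1 /= lerD2l lerN2.
rewrite /Phi /Rintegral fine_le //.
- by apply: integrable_fin_num => //; apply: integrableS integrable_phi.
- by apply: integrable_fin_num => //; apply: integrableS integrable_phi.
- apply: ge0_subset_integral => //.
  + by apply/measurable_EFinP; apply: measurable_funTS; exact: measurable_phi.
  + by move=> z _; rewrite lee_fin ltW // phi_gt0.
  + by move=> z; rewrite /= !in_itv /= => /andP[].
Unshelve. all: by end_near. Qed.

Lemma has_deriv_Phibar u : has_deriv Phibar u (- phi u).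
Proof.
apply: has_deriv_eq; first exact: has_derivB (has_deriv_cst _ _) (has_deriv_Phi u).
by rewrite sub0r.
Qed.

Lemma Phibar_gt0 u : 0 < Phibar u.
Proof.
have uu1 : u < u + 1 by rewrite ltrDl.
apply: (@le_lt_trans _ _ (Phibar (u + 1))); first by rewrite subr_ge0 Phi_le1.
rewrite -ltrN2; apply: (increasing_derive (f := fun x => - Phibar x) (f' := phi) uu1).
- move=> x _; apply: has_deriv_eq; first exact: has_derivN (has_deriv_Phibar x).
  by rewrite opprK.
- by move=> x _; exact: phi_gt0.
Qed.

Lemma invMills_gt0 u : 0 < invMills u.
Proof. by rewrite divr_gt0 ?phi_gt0 ?Phibar_gt0. Qed.

Lemma has_deriv_invMills u :
  has_deriv invMills u (invMills u * (invMills u - u)).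
Proof.
have Pu := gt_eqF (Phibar_gt0 u).
apply: has_deriv_eq.
  by apply: has_deriv_div (has_deriv_phi u) (has_deriv_Phibar u); rewrite Pu.
by rewrite /invMills; field; rewrite Pu.
Qed.

End tail.

(** * Comparison principle for the inverse Mills ratio *)

Section comparison.
Context {R : realType}.
Implicit Types (W b : R -> R) (u x a m l : R).

(** A function that vanishes at infinity and whose derivative changes sign at
    most once, from plus to minus, is nonnegative on a half line as soon as it
    is so at the end point: before the change it is above its initial value,
    after it, above its limit. *)
Lemma ge0_unimodal W (W' : R -> R) a : (forall x, a <= x -> has_deriv W x (W' x)) ->
  (forall x y, a <= x -> x <= y -> W' x <= 0 -> W' y <= 0) ->
  W n%:R @[n --> \oo] --> (0 : R) ->
  W' a <= 0 \/ 0 <= W a -> forall x, a <= x -> 0 <= W x.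
Proof.
move=> dW W'x W0 Wa x ax.
have after y : a <= y -> W' y <= 0 -> 0 <= W y.
  move=> ay W'y; apply: (cvgr_to_le W0); near=> n.
  have yn : y <= n%:R by near: n; exact: nbhs_infty_ger.
  rewrite -lerN2; apply: (nondecreasing_derive (f := fun x => - W x)
    (f' := fun x => - W' x)) => // z /andP[yz zn].
    exact/has_derivN/dW/(le_trans ay).
  by rewrite oppr_ge0 (W'x y).
have [/(after x ax)//|W'x0] := leP (W' x) 0.
have {}Wa : 0 <= W a by case: Wa => // /(after a (lexx _)).
apply: (le_trans Wa); apply: (nondecreasing_derive (f' := W')) => // y /andP[ay yx].
  exact: dW.
by rewrite leNgt; apply: contraTN W'x0 => /ltW W'y; rewrite -leNgt (W'x y).
Unshelve. all: by end_near. Qed.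

(** Dividing [phi] by a candidate [b] turns the comparison of [e] with [b] into
    the sign of a function whose derivative only involves [b]. *)
Lemma has_deriv_mills_diff b (b' : R -> R) x : b x != 0 -> has_deriv b x (b' x) ->
  has_deriv (fun y => Phibar y - phi y / b y) x
    (phi x / b x ^+ 2 * (b' x - b x * (b x - x))).
Proof.
move=> b0 db; apply: has_deriv_eq.
  exact: has_derivB (has_deriv_Phibar x) (has_deriv_div b0 (has_deriv_phi x) db).
by field.
Qed.

Lemma cvg_mills_diff b a m : 0 < m -> (forall x, a <= x -> m <= b x) ->
  Phibar n%:R - phi n%:R / b n%:R @[n --> \oo] --> (0 : R).
Proof.
move=> m0 mb; rewrite -[X in _ --> X](subr0 0); apply: cvgB; first exact: cvg_Phibar.
have h : phi n%:R / m @[n --> \oo] --> (0 : R).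
  rewrite -(mul0r m^-1); apply: cvgM; last exact: cvg_cst.
  by apply: cvg_comp cvgy_phi; exact: cvgr_idn.
apply: (@squeeze_cvgr _ _ _ _ (cst 0) _ _ _ _ _ h); last exact: cvg_cst.
near=> n; have an : a <= n%:R by near: n; exact: nbhs_infty_ger.
have mbn := mb _ an; have b0 := lt_le_trans m0 mbn.
rewrite /= divr_ge0 ?(ltW b0) ?(ltW (phi_gt0 _)) //=.
by rewrite ler_wpM2l ?(ltW (phi_gt0 _)) // lef_pV2.
Unshelve. all: by end_near. Qed.

(** [e <= b] means [0 <= Phibar - phi / b]. This difference vanishes at infinity
    and moves in the direction dictated by the sign of [b' - b (b - x)], the defect
    of [b] in the equation [e' = e (e - x)]. *)
Lemma invMills_le b (b' : R -> R) a m : 0 < m -> (forall x, a <= x -> m <= b x) ->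
  (forall x, a <= x -> has_deriv b x (b' x)) ->
  (forall x y, a <= x -> x <= y ->
     b' x <= b x * (b x - x) -> b' y <= b y * (b y - y)) ->
  b' a <= b a * (b a - a) \/ invMills a <= b a ->
  forall x, a <= x -> invMills x <= b x.
Proof.
move=> m0 mb db bE ba x ax.
have b0 y : a <= y -> 0 < b y by move=> /mb; exact: lt_le_trans.
have c0 y : a <= y -> 0 < phi y / b y ^+ 2.
  by move=> ay; rewrite divr_gt0 ?phi_gt0 ?exprn_gt0 ?b0.
have W0 y : a <= y -> (0 <= Phibar y - phi y / b y) = (invMills y <= b y).
  by move=> ay; rewrite subr_ge0 ler_pdivrMr ?b0 // ler_pdivrMr ?Phibar_gt0 // mulrC.
have W'0 y : a <= y -> (phi y / b y ^+ 2 * (b' y - b y * (b y - y)) <= 0) =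
    (b' y <= b y * (b y - y)).
  by move=> ay; rewrite pmulr_rle0 ?c0 // subr_le0.
rewrite -W0 //; apply: (@ge0_unimodal (fun y => Phibar y - phi y / b y)
  (fun y => phi y / b y ^+ 2 * (b' y - b y * (b y - y))) a).
- move=> y ay; apply: has_deriv_mills_diff; [by rewrite gt_eqF ?b0|exact: db].
- by move=> y z ay yz; rewrite !W'0 ?(le_trans ay) //; exact: bE.
- exact: cvg_mills_diff m0 mb.
- by rewrite W'0 // W0.
- exact: ax.
Qed.

Lemma invMills_ge b (b' : R -> R) a m : 0 < m -> (forall x, a <= x -> m <= b x) ->
  (forall x, a <= x -> has_deriv b x (b' x)) ->
  (forall x y, a <= x -> x <= y ->
     b x * (b x - x) <= b' x -> b y * (b y - y) <= b' y) ->
  b a * (b a - a) <= b' a \/ b a <= invMills a ->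
  forall x, a <= x -> b x <= invMills x.
Proof.
move=> m0 mb db bE ba x ax.
have b0 y : a <= y -> 0 < b y by move=> /mb; exact: lt_le_trans.
have c0 y : a <= y -> 0 < phi y / b y ^+ 2.
  by move=> ay; rewrite divr_gt0 ?phi_gt0 ?exprn_gt0 ?b0.
have W0 y : a <= y -> (0 <= - (Phibar y - phi y / b y)) = (b y <= invMills y).
  move=> ay; rewrite oppr_ge0 subr_le0 ler_pdivlMr ?b0 //.
  by rewrite ler_pdivlMr ?Phibar_gt0 // mulrC.
have W'0 y : a <= y -> (- (phi y / b y ^+ 2 * (b' y - b y * (b y - y))) <= 0) =
    (b y * (b y - y) <= b' y).
  by move=> ay; rewrite oppr_le0 pmulr_rge0 ?c0 // subr_ge0.
rewrite -W0 //; apply: (@ge0_unimodal (fun y => - (Phibar y - phi y / b y))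
  (fun y => - (phi y / b y ^+ 2 * (b' y - b y * (b y - y)))) a).
- move=> y ay; apply/has_derivN/has_deriv_mills_diff; last exact: db.
  by rewrite gt_eqF ?b0.
- by move=> y z ay yz; rewrite !W'0 ?(le_trans ay) //; exact: bE.
- by rewrite -oppr0; apply: cvgN; exact: cvg_mills_diff m0 mb.
- by rewrite W'0 // W0.
- exact: ax.
Qed.

Lemma has_deriv_sqrt_sqrD m x : 0 < m ->
  has_deriv (fun y => Num.sqrt (y ^+ 2 + m)) x (x / Num.sqrt (x ^+ 2 + m)).
Proof.
move=> m0; have s0 : 0 < x ^+ 2 + m by rewrite ltr_wpDl ?sqr_ge0.
apply: has_deriv_eq.
  apply: (@has_deriv_sqrt _ (fun y => y ^+ 2 + m) _ _ s0).
  exact: (has_derivD (has_deriv_sqr (has_deriv_id x)) (has_deriv_cst m x)).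
by rewrite /=; field; rewrite gt_eqF // sqrtr_gt0.
Qed.

Lemma lt_sqrt_sqrD m x : 0 < m -> `|x| < Num.sqrt (x ^+ 2 + m).
Proof. by move=> m0; rewrite -sqrtr_sqr ltr_sqrt ?ltrDl // ltr_wpDl ?sqr_ge0. Qed.

Lemma sqr_sqrt_sqrD m x : 0 < m -> Num.sqrt (x ^+ 2 + m) ^+ 2 = x ^+ 2 + m.
Proof. by move=> m0; rewrite sqr_sqrtr // addr_ge0 ?sqr_ge0 // ltW. Qed.

(** The defects of the bounds used below have the sign of
    [c sqrt (x^2 + m) - x] up to a positive factor, and so change sign at most once,
    since the square root is 1-Lipschitz in [x]. *)
Lemma sqrt_sqrD_crossing m c x y : 0 < m -> 0 <= c <= 1 -> 0 <= x -> x <= y ->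
  c * Num.sqrt (x ^+ 2 + m) <= x -> c * Num.sqrt (y ^+ 2 + m) <= y.
Proof.
move=> m0 /andP[c0 c1] x0 xy cx.
have := lt_sqrt_sqrD x m0; rewrite ger0_norm // => xs.
have := lt_sqrt_sqrD y m0; rewrite ger0_norm ?(le_trans x0) // => ys.
have := sqr_sqrt_sqrD x m0; have := sqr_sqrt_sqrD y m0.
set s := Num.sqrt (x ^+ 2 + m) in cx xs *; set t := Num.sqrt (y ^+ 2 + m) in ys *.
move=> t2 s2; have ts : t - s <= y - x.
  have : (t - s) * (t + s) = (y - x) * (y + x) by nra.
  by nra.
have : c * (t - s) <= y - x by nra.
by lra.
Qed.

(** The root [((l - 1) x + sqrt (x^2 + 2 l)) / l] of
    [2 b (b - x) + (l - 2) (b - x)^2 = 2], a family of upper bounds that contains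
    the classical bounds of Birnbaum, [l = 2], and, for [x >= 0], of Boyd,
    [l = pi]. *)
Definition mills_ub l x := ((l - 1) * x + Num.sqrt (x ^+ 2 + 2 * l)) / l.

Definition mills_ub' l x := ((l - 1) + x / Num.sqrt (x ^+ 2 + 2 * l)) / l.

Lemma has_deriv_mills_ub l x : 0 < l -> has_deriv (mills_ub l) x (mills_ub' l x).
Proof.
move=> l0; have l20 : 0 < 2 * l by rewrite mulr_gt0.
apply: has_deriv_eq.
  apply: has_derivM (has_deriv_cst _ _).
  apply: has_derivD (has_derivZ _ (has_deriv_id x)) (has_deriv_sqrt_sqrD x l20).
by rewrite /mills_ub'; ring.
Qed.

(** With [t = sqrt (x^2 + 2 l)] one finds
    [b (b - x) - b' = (t - x) (x - (l - 3) t) / (l t (t + x))]. *)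
Lemma mills_ub_defect l x : 0 < l ->
  (mills_ub' l x <= mills_ub l x * (mills_ub l x - x)) =
  ((l - 3) * Num.sqrt (x ^+ 2 + 2 * l) <= x).
Proof.
move=> l0; have l20 : 0 < 2 * l by rewrite mulr_gt0.
have := lt_sqrt_sqrD x l20; have := sqr_sqrt_sqrD x l20.
rewrite /mills_ub /mills_ub'; set s := Num.sqrt _ => s2.
rewrite ltr_norml => /andP[xs sx].
(* Eliminating [l] makes the identity rational in [s] and [x]. *)
have lE : l = (s ^+ 2 - x ^+ 2) / 2 by rewrite s2; field.
have s0 : 0 < s by lra.
rewrite -subr_ge0 (_ : _ - _ = (s - x) / (l * s * (s + x)) * (x - (l - 3) * s)).
  by rewrite pmulr_rge0 ?subr_ge0 // divr_gt0 // ?mulr_gt0 //; lra.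
have l1 : s ^+ 2 - x ^+ 2 != 0 by rewrite s2; apply/eqP; lra.
rewrite lE; field.
rewrite !gt_eqF // ?l1 //=; lra.
Qed.

Lemma mills_ub_eqn l x u : 0 < l -> (l - 1) * x - Num.sqrt (x ^+ 2 + 2 * l) <= l * u ->
  u <= mills_ub l x -> 2 * (u * (u - x)) + (l - 2) * (u - x) ^+ 2 <= 2.
Proof.
move=> l0; have l20 : 0 < 2 * l by rewrite mulr_gt0.
have := sqr_sqrt_sqrD x l20; rewrite /mills_ub; set s := Num.sqrt _ => s2 h1.
rewrite ler_pdivlMr // => h2.
have : (l * u - (l - 1) * x) ^+ 2 <= s ^+ 2.
  by rewrite -subr_ge0 subr_sqr mulr_ge0 //; lra.
rewrite s2 => h; rewrite -(ler_pM2l l0); nra.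
Qed.

Lemma phi0_sqr : phi 0 ^+ 2 = (2 * pi)^-1 :> R.
Proof.
rewrite /phi expr0n oppr0 mul0r expR0 mulr1 exprVn sqr_sqrtr //.
by rewrite mulr_ge0 // pi_ge0.
Qed.

Lemma invMills0 : invMills 0 = 2 * phi 0 :> R.
Proof. by rewrite /invMills /Phibar Phi0; field. Qed.

Lemma sqr_invMills0 : invMills 0 ^+ 2 = 2 / pi :> R.
Proof.
have := @pi_gt0 R; rewrite invMills0 exprMn phi0_sqr; move: (pi : R) => p p0.
by field; rewrite gt_eqF.
Qed.

(** Case [l = 2] of [mills_ub], where the defect has the right sign on the whole
    line. *)
Lemma invMills_slope_le1 u : invMills u * (invMills u - u) <= 1.
Proof.
have l0 : 0 < 2 :> R by [].
have l20 : 0 < 2 * 2 :> R by rewrite mulr_gt0.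
have m0 : 0 < (`|u| + 1)^-1 by rewrite invr_gt0 ltr_wpDl.
(* For [t = sqrt (x^2 + 4)], bounding [x + t] from below amounts to bounding
   [t - x] from above, as [(x + t) (t - x) = 4]. *)
have mb x : u <= x -> (`|u| + 1)^-1 <= mills_ub 2 x.
  move=> ux; rewrite /mills_ub.
  have := lt_sqrt_sqrD x l20; have := sqr_sqrt_sqrD x l20.
  set s := Num.sqrt _ => s2; rewrite ltr_norml => /andP[xs sx].
  have xu : `|x| - x <= 2 * `|u|.
    have [x0|x0] := leP 0 x; first by rewrite ger0_norm // subrr mulr_ge0.
    by rewrite (ltr0_norm x0) (ltr0_norm (le_lt_trans ux x0)); lra.
  have sx2 : s <= `|x| + 2.
    rewrite -ler_sqr ?nnegrE ?addr_ge0 //; last by lra.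
    by rewrite s2 sqrrD real_normK ?num_real //; have := normr_ge0 x; nra.
  have u1 : 0 < `|u| + 1 by rewrite ltr_wpDl.
  have -> : 2 - 1 = 1 :> R by ring.
  rewrite mul1r -[leLHS]mul1r ler_pdivrMr // mulrAC ler_pdivlMr //.
  have : (x + s) * (s - x) = 4 by nra.
  have : s - x <= 2 * (`|u| + 1) by lra.
  nra.
have slope x : mills_ub' 2 x <= mills_ub 2 x * (mills_ub 2 x - x).
  rewrite mills_ub_defect //.
  by have := lt_sqrt_sqrD x l20; rewrite ltr_norml => /andP[? ?]; lra.
have := @invMills_le (mills_ub 2) (mills_ub' 2) u _ m0 mb _ _ _ u (lexx _).
move=> /(_ (fun x _ => has_deriv_mills_ub x l0) (fun x y _ _ _ => slope y)).
move=> /(_ (or_introl (slope u))).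
have [eu|eu] := ltP (invMills u) (u / 2).
  move=> _; apply: (@le_trans _ _ 0) => //.
  by have := invMills_gt0 u; nra.
move=> /(@mills_ub_eqn 2 u _ l0); have s0 := sqrtr_ge0 (u ^+ 2 + 2 * 2).
move=> h; have : 2 * (invMills u * (invMills u - u)) +
    (2 - 2) * (invMills u - u) ^+ 2 <= 2.
  by apply: h; lra.
by rewrite subrr mul0r addr0; lra.
Qed.

End comparison.

(** * A lower bound on pi *)

Section pi_bound.
Context {R : realType}.
Implicit Types (f g : R -> R) (x y : R).

(** Integration of inequalities, used to climb up the Taylor expansion of [cos]. *)
Lemma ler_of_deriv f g (f' g' : R -> R) x : f 0 <= g 0 ->
  (forall y, has_deriv f y (f' y)) -> (forall y, has_deriv g y (g' y)) ->
  (forall y, 0 <= y -> f' y <= g' y) -> 0 <= x -> f x <= g x.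
Proof.
move=> fg0 df dg f'g' x0; rewrite -subr_ge0.
apply: (@le_trans _ _ (g 0 - f 0)); first by rewrite subr_ge0.
apply: (nondecreasing_derive (f := fun y => g y - f y)
  (f' := fun y => g' y - f' y)) => //.
- by move=> y _; exact: has_derivB.
- by move=> y /andP[y0 _]; rewrite subr_ge0 f'g'.
Qed.

Lemma has_deriv_monomial (c : R) n x :
  has_deriv (fun y => c * y ^+ n.+1) x (c * n.+1%:R * x ^+ n).
Proof.
rewrite -mulrA; apply: has_derivZ; elim: n => [|n IH].
  by rewrite mul1r; exact: has_deriv_id.
under eq_fun do rewrite exprSr.
apply: has_deriv_eq; first exact: (has_derivM IH (has_deriv_id x)).
by rewrite mulr1 -[in RHS]natr1 mulrDl mul1r -mulrA -exprSr.
Qed.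

Lemma has_deriv_sin x : has_deriv sin x (cos x).
Proof. exact: is_derive_sin. Qed.

Lemma has_deriv_cos x : has_deriv cos x (- sin x).
Proof. exact: is_derive_cos. Qed.

Lemma cos_ge_taylor6 x : 0 <= x ->
  1 - 2^-1 * x ^+ 2 + 24^-1 * x ^+ 4 - 720^-1 * x ^+ 6 <= cos x.
Proof.
have d0 (z : R) : has_deriv (fun=> 1) z 0 := has_deriv_cst 1 z.
have d1 (z : R) : has_deriv (fun y => y) z 1 := has_deriv_id z.
have d2 z := has_derivB (d0 z) (has_deriv_monomial 2^-1 1 z).
have d3 z := has_derivB (d1 z) (has_deriv_monomial 6^-1 2 z).
have d4 z := has_derivD (d2 z) (has_deriv_monomial 24^-1 3 z).
have d5 z := has_derivD (d3 z) (has_deriv_monomial 120^-1 4 z).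
have d6 z := has_derivB (d4 z) (has_deriv_monomial 720^-1 5 z).
have sin1 y : 0 <= y -> sin y <= y.
  apply: (ler_of_deriv _ has_deriv_sin d1); first by rewrite sin0.
  by move=> z _; exact: cos_le1.
have cos2 y : 0 <= y -> 1 - 2^-1 * y ^+ 2 <= cos y.
  apply: (ler_of_deriv _ d2 has_deriv_cos); first by rewrite cos0; lra.
  by move=> z /sin1; rewrite expr1; lra.
have sin3 y : 0 <= y -> y - 6^-1 * y ^+ 3 <= sin y.
  apply: (ler_of_deriv _ d3 has_deriv_sin); first by rewrite sin0; lra.
  by move=> z /cos2; lra.
have cos4 y : 0 <= y -> cos y <= 1 - 2^-1 * y ^+ 2 + 24^-1 * y ^+ 4.
  apply: (ler_of_deriv _ has_deriv_cos d4); first by rewrite cos0; lra.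
  by move=> z /sin3; rewrite expr1; lra.
have sin5 y : 0 <= y -> sin y <= y - 6^-1 * y ^+ 3 + 120^-1 * y ^+ 5.
  apply: (ler_of_deriv _ has_deriv_sin d5); first by rewrite sin0; lra.
  by move=> z /cos4; lra.
apply: (ler_of_deriv _ d6 has_deriv_cos); first by rewrite cos0; lra.
by move=> z /sin5; rewrite expr1; lra.
Qed.

(** [pi / 2] is the first zero of [cos], and the Taylor bound shows that [cos] is
    still positive at [25 / 16]. *)
Lemma pi_ge_25_8 : 25 / 8 <= pi :> R.
Proof.
have pi2 := @pihalf_ge1 R; have pi3 := @pihalf_lt2 R.
rewrite leNgt; apply/negP => pi25.
have : cos (25 / 16) <= cos (pi / 2) :> R.
  by rewrite ltW // ltr_cos ?in_itv /=; lra.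
rewrite cos_pihalf; apply/negP; rewrite -ltNge.
apply: (lt_le_trans _ (@cos_ge_taylor6 (25 / 16) _)); last by lra.
by lra.
Qed.

End pi_bound.

(** * The sign of the drift *)

Section drift.
Context {R : realType}.
Implicit Types (u x : R).

(** The positive root [b] of [b (b - x) = c] is a lower bound where [c <= b']. This
    holds from some point on, as [b'] increases to [1]; before that point it is
    enough that the bound holds at [0], and [c = 2 / pi] is the largest constant
    for which it does, since [e(0)^2 = 2 / pi]. *)
Lemma invMills_slope_ge u : 0 <= u ->
  2 / pi <= invMills u * (invMills u - u) :> R.
Proof.
have pi0 := @pi_gt0 R; have pi2 := @pi_ge2 R; have pi4 := @pihalf_lt2 R.
set c : R := 2 / pi.
have c0 : 0 < c by rewrite divr_gt0.
have c40 : 0 < 4 * c by rewrite mulr_gt0.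
have cpi : c * pi = 2 by rewrite divfK ?gt_eqF.
have c1 : c <= 1 by nra.
have c2 : 1 <= 2 * c by nra.
pose b x := (x + Num.sqrt (x ^+ 2 + 4 * c)) / 2.
pose b' x := (1 + x / Num.sqrt (x ^+ 2 + 4 * c)) / 2.
have db x : 0 <= x -> has_deriv b x (b' x).
  move=> _; apply: has_deriv_eq.
    apply: has_derivM (has_deriv_cst _ _).
    exact: has_derivD (has_deriv_id x) (has_deriv_sqrt_sqrD x c40).
  by rewrite /b'; ring.
have bb x : b x * (b x - x) = c.
  by have := sqr_sqrt_sqrD x c40; rewrite /b; set s := Num.sqrt _; nra.
have b'E x : (b x * (b x - x) <= b' x) = ((2 * c - 1) * Num.sqrt (x ^+ 2 + 4 * c) <= x).
  rewrite bb /b' ler_pdivlMr // -lerBlDl mulrC ler_pdivlMr //.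
  by rewrite sqrtr_gt0 ltr_wpDl ?sqr_ge0.
have m0 : 0 < Num.sqrt (4 * c) / 2 by rewrite divr_gt0 // sqrtr_gt0.
have mb x : 0 <= x -> Num.sqrt (4 * c) / 2 <= b x.
  move=> x0; rewrite /b ler_pM2r ?invr_gt0 // -[leLHS]add0r lerD //.
  by rewrite ler_wsqrtr // lerDr sqr_ge0.
have b0 : b 0 <= invMills 0.
  rewrite /b add0r expr0n add0r -ler_sqr ?nnegrE ?(ltW m0) ?(ltW (invMills_gt0 _)) //.
  by rewrite sqr_invMills0 exprMn sqr_sqrtr ?(ltW c40) // -/c; lra.
move=> u0.
have cross x y : 0 <= x -> x <= y -> b x * (b x - x) <= b' x -> b y * (b y - y) <= b' y.
  move=> x0 xy; rewrite !b'E; apply: sqrt_sqrD_crossing => //.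
  by apply/andP; split; lra.
have := @invMills_ge _ b b' 0 _ m0 mb db cross (or_intror b0) u u0.
have := sqr_sqrt_sqrD u c40; have := lt_sqrt_sqrD u c40; rewrite ger0_norm // /b.
by set s := Num.sqrt _; set e := invMills u; nra.
Qed.

Lemma invMills_gt u : u < invMills u.
Proof.
have e0 := invMills_gt0 u; have [u0|/lt_trans] := leP 0 u; last exact.
have c0 : 0 < 2 / pi :> R by rewrite divr_gt0 // pi_gt0.
have := lt_le_trans c0 (invMills_slope_ge u0).
by rewrite pmulr_rgt0 // subr_gt0.
Qed.

(** Case [l = pi] of [mills_ub], the value of [l] that makes the bound an equality
    at [0]. *)
Lemma invMills_boyd u : 0 <= u ->
  2 * (invMills u * (invMills u - u)) + (pi - 2) * (invMills u - u) ^+ 2 <= 2.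
Proof.
have pi3 := @pi_ge_25_8 R; have pi4 := @pihalf_lt2 R; have pi0 := @pi_gt0 R.
move: (@sqr_invMills0 R) pi3 pi4 pi0; move: (pi : R) => l e0 l3 l4 l0 u0.
have l20 : 0 < 2 * l by rewrite mulr_gt0.
have m0 : 0 < Num.sqrt (2 * l) / l by rewrite divr_gt0 // sqrtr_gt0.
apply: mills_ub_eqn => //.
  have := lt_sqrt_sqrD u l20; rewrite ger0_norm //.
  set s := Num.sqrt _ => us.
  by have := invMills_gt u; nra.
apply: (@invMills_le _ _ (mills_ub' l) 0 _ m0) => //.
- move=> x x0; rewrite /mills_ub ler_pM2r ?invr_gt0 // -[leLHS]add0r lerD //.
    by rewrite mulr_ge0 //; lra.
  by rewrite ler_wsqrtr // lerDr sqr_ge0.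
- by move=> x _; exact: has_deriv_mills_ub.
- move=> x y x0 xy; rewrite !mills_ub_defect //.
  by apply: sqrt_sqrD_crossing => //; apply/andP; split; lra.
right; rewrite /mills_ub mulr0 add0r expr0n add0r.
rewrite -ler_sqr ?nnegrE ?(ltW m0) ?(ltW (invMills_gt0 _)) //.
rewrite e0 exprMn sqr_sqrtr ?(ltW l20) // le_eqVlt; apply/orP; left.
by apply/eqP; field; rewrite gt_eqF.
Qed.

(** The quantity whose mean gives the sign of the derivative of [energy]; see
    [has_deriv_energy]. *)
Definition drift u := invMills u ^+ 2 *
  ((invMills u - u) ^+ 2 + 2 * (invMills u * (invMills u - u)) - 2).

(** [invMills_boyd] bounds the second factor of [drift] by [- (pi - 3) (e - u)^2],
    whence [drift <= - (pi - 3) (e')^2 <= - 4 (pi - 3) / pi^2]. *)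
Lemma drift_le_right u : 0 <= u -> drift u <= - 20^-1.
Proof.
move=> u0; have := invMills_boyd u0; have := invMills_slope_ge u0.
have := invMills_gt0 u; have := invMills_gt u.
have := @pi_ge_25_8 R; have := @pihalf_lt2 R; have pi0 := @pi_gt0 R.
rewrite /drift; set e := invMills u; move: (pi : R) pi0 => p p0 p4 p3 ue e0.
rewrite ler_pdivrMr // => k2 boyd.
set k := e * (e - u) in k2 boyd *.
have k2' : 4 <= k ^+ 2 * p ^+ 2 by rewrite -exprMn; nra.
have p2 : p ^+ 2 <= 80 * (p - 3) by nra.
have h : 20^-1 <= (p - 3) * k ^+ 2.
  have : 4 <= k ^+ 2 * (80 * (p - 3)).
    by apply: le_trans k2' _; rewrite ler_wpM2l ?sqr_ge0.
  by lra.
apply: (@le_trans _ _ (- ((p - 3) * k ^+ 2))); last by rewrite lerN2.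
rewrite (_ : (p - 3) * k ^+ 2 = e ^+ 2 * ((p - 3) * (e - u) ^+ 2)); last first.
  by rewrite /k; ring.
by rewrite -mulrN ler_wpM2l ?sqr_ge0 //; lra.
Qed.

(** With [k = e (e - u)] and [w = e^2 (1 - k)], the value of [drift] is
    [k^2 - 2 w], and at a critical point [e^2 (w + 3 k - 4 k^2) = k^3], that is,
    [w (w + 3 k - 4 k^2) = k^3 (1 - k)]. This determines [w] from [k], and a value
    of [drift] above [1/20] would make [w] too small for it. *)
Lemma drift_critical (e k : R) : 0 < e -> 0 < k -> k <= 1 ->
  e ^+ 2 * (e ^+ 2 * (1 - k) + 3 * k - 4 * k ^+ 2) = k ^+ 3 ->
  k ^+ 2 - 2 * (e ^+ 2 * (1 - k)) <= 20^-1.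
Proof.
move=> e0 k0 k1 crit; rewrite leNgt; apply/negP => w0.
have e20 : 0 < e ^+ 2 by rewrite exprn_gt0.
have k30 : 0 < k ^+ 3 by rewrite exprn_gt0.
set w := e ^+ 2 * (1 - k) in w0 crit.
have k1' : 0 < 1 - k.
  rewrite lt_neqAle subr_ge0 k1 andbT; apply/eqP => k1'.
  have kE : k = 1 by lra.
  by move: crit; rewrite /w kE; nra.
have ww : w * (w + 3 * k - 4 * k ^+ 2) = k ^+ 3 * (1 - k) by rewrite -crit /w; ring.
have w1 : 0 < w by rewrite mulr_gt0.
have w2 : 0 < w + 3 * k - 4 * k ^+ 2.
  by rewrite -(pmulr_rgt0 _ e20) crit.
set v := (k ^+ 2 - 20^-1) / 2.
have wv : w < v by rewrite /v; lra.
have : k ^+ 3 * (1 - k) < v * (v + 3 * k - 4 * k ^+ 2).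
  by rewrite -ww; nra.
apply/negP; rewrite -leNgt -subr_ge0.
have k5 : 1 / 5 < k by nra.
rewrite (_ : _ - _ =
  k * (3/4 * k ^+ 3 - 1/2 * k ^+ 2 - 3/40 * k + 3/40) - 1/1600); last first.
  by rewrite /v; field.
(* The cubic is smallest near [k = 1/2]. *)
have h : 1/320 <= 3/4 * k ^+ 3 - 1/2 * k ^+ 2 - 3/40 * k + 3/40.
  rewrite (_ : k = k - 1/2 + 1/2); last by ring.
  have : - (3/10) <= k - 1/2 <= 1/2 by apply/andP; split; lra.
  set t := k - 1/2 => /andP[t1 t2].
  have : 0 <= t ^+ 2 * (t + 3/10) by rewrite mulr_ge0 ?sqr_ge0 //; lra.
  have : 0 <= (t - 1/64) ^+ 2 by exact: sqr_ge0.
  by nra.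
by nra.
Qed.

Lemma has_deriv_drift u : has_deriv drift u
  (2 * invMills u ^+ 2 * (invMills u ^+ 2 * (invMills u - u) +
   4 * invMills u * (invMills u - u) ^+ 2 + (invMills u - u) ^+ 3
   - 3 * (invMills u - u) - invMills u)).
Proof.
have de := has_deriv_invMills u.
have dy := has_derivB de (has_deriv_id u).
apply: has_deriv_eq.
  exact: (has_derivM (has_deriv_sqr de) (has_derivB (has_derivD
    (has_deriv_sqr dy) (has_derivZ 2 (has_derivM de dy))) (has_deriv_cst 2 u))).
by rewrite /=; ring.
Qed.

Lemma invMills_nondecreasing x u : x <= u -> invMills x <= invMills u.
Proof.
move=> xu; apply: (nondecreasing_derive _ (fun z _ => has_deriv_invMills z)) => // z _.
by rewrite mulr_ge0 // ?subr_ge0 ltW // ?invMills_gt0 // invMills_gt.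
Qed.

Lemma invMills0_le1 : invMills 0 <= 1 :> R.
Proof.
rewrite -(@ler_pXn2r _ 2) ?nnegrE ?(ltW (invMills_gt0 _)) // expr1n sqr_invMills0.
by rewrite ler_pdivrMr ?pi_gt0 // mul1r pi_ge2.
Qed.

Lemma phi_le1 x : phi x <= 1 :> R.
Proof.
have -> : phi x = phi 0 * expR (- x ^+ 2 / 2).
  by rewrite /phi expr0n oppr0 mul0r expR0 mulr1.
have p0 : phi 0 <= 1 :> R by have := invMills0_le1; rewrite invMills0; lra.
rewrite mulr_ile1 ?expR_ge0 ?(ltW (phi_gt0 _)) //.
by rewrite -expR0 ler_expR mulNr oppr_le0 divr_ge0 ?sqr_ge0.
Qed.

Lemma invMills_left u : u <= 0 -> invMills u <= 2 * phi u.
Proof.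
move=> u0; rewrite ler_pdivrMr ?Phibar_gt0 //.
have : Phibar 0 <= Phibar u.
  rewrite -lerN2.
  apply: (nondecreasing_derive (f := fun x => - Phibar x) (f' := phi) u0).
  - move=> z _; apply: has_deriv_eq; first exact: has_derivN (has_deriv_Phibar z).
    by rewrite opprK.
  - by move=> z _; exact/ltW/phi_gt0.
by rewrite {1}/Phibar Phi0 => h; have := phi_gt0 u; nra.
Qed.

(** For negative [x], [e <= 2 phi], so that [drift] decays like [phi]; the point
    [-100] leaves room for crude constants. *)
Lemma drift_far x : x <= - 100 -> drift x < 20^-1.
Proof.
move=> x100; have x0 : x <= 0 by lra.
have e0 := invMills_gt0 x; have e2 := invMills_left x0.
have e1 : invMills x <= 1 := le_trans (invMills_nondecreasing x0) invMills0_le1.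
have p0 := phi_gt0 x; have p1 := phi_le1 x; have := phi_decay x.
rewrite /drift; set e := invMills x in e0 e2 e1 *; set p := phi x in p0 p1 e2 *.
move=> h.
have h1 : (e - x) ^+ 2 + 2 * (e * (e - x)) - 2 <= 5 * (1 + x ^+ 2) by nra.
have h2 : e ^+ 2 <= 4 * p by nra.
have h3 : drift x <= 20 * ((1 + x ^+ 2) * p).
  apply: (@le_trans _ _ (e ^+ 2 * (5 * (1 + x ^+ 2)))).
    by rewrite ler_wpM2l ?sqr_ge0.
  rewrite (_ : 20 * _ = 4 * p * (5 * (1 + x ^+ 2))); last by ring.
  by rewrite ler_wpM2r // mulr_ge0 // addr_ge0 ?sqr_ge0.
apply: (le_lt_trans h3).
have x2 : 10000 <= x ^+ 2 by nra.
set q := (1 + x ^+ 2) * p in h *.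
have q0 : 0 <= q by rewrite mulr_ge0 ?(ltW p0) // addr_ge0 ?sqr_ge0.
by nra.
Qed.

(** A value above [1/20] would force a maximum above [1/20] inside the segment
    from [-100] to [0], since the values at both ends are smaller; this
    contradicts [drift_critical]. *)
Lemma drift_le_left u : u <= 0 -> drift u <= 20^-1.
Proof.
move=> u0; rewrite leNgt; apply/negP => du.
have uN : - 100 < u by rewrite ltNge; apply/negP => /drift_far; lra.
have N0 : - 100 <= 0 :> R by lra.
have [|c cN cmax] := @EVT_max _ drift _ _ N0.
  apply: continuous_subspaceT => x; exact: has_deriv_continuous (has_deriv_drift x).
have dc : 20^-1 < drift c.
  by apply: lt_le_trans (cmax u _) => //; rewrite in_itv /= u0 ltW.
have c0 : c < 0.
  rewrite ltNge; apply/negP => /drift_le_right; lra.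
have cN' : - 100 < c by rewrite ltNge; apply/negP => /drift_far; lra.
have : is_derive c 1 drift 0.
  apply: (@derive1_at_max _ _ (- 100) 0) => //.
  - by move=> t _; case: (has_deriv_drift t).
  - by rewrite in_itv /= cN'.
  - by move=> t; rewrite in_itv /= => /andP[? ?]; apply: cmax; rewrite in_itv /= !ltW.
move=> [_ d0]; case: (has_deriv_drift c) => _; rewrite d0 => /esym.
have e0 := invMills_gt0 c; have y0 := invMills_gt c; have k1 := invMills_slope_le1 c.
move: dc; rewrite /drift; move: (invMills c) e0 y0 k1 => e e0 y0; set y := e - c.
move=> k1 dc /eqP; rewrite mulf_eq0 gt_eqF ?mulr_gt0 ?exprn_gt0 //= => /eqP crit.
have y0' : 0 < y by rewrite subr_gt0.
have k0 : 0 < e * y by rewrite mulr_gt0.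
have := @drift_critical e (e * y) e0 k0 k1 _.
have -> : (e * y) ^+ 2 - 2 * (e ^+ 2 * (1 - e * y)) =
  e ^+ 2 * (y ^+ 2 + 2 * (e * y) - 2) by ring.
move=> h; have : e ^+ 2 * (y ^+ 2 + 2 * (e * y) - 2) <= 20^-1.
  apply: h; apply/eqP; rewrite -subr_eq0.
  rewrite (_ : _ - _ = - e ^+ 3 * (e ^+ 2 * y + 4 * e * y ^+ 2 + y ^+ 3 - 3 * y - e)).
    by rewrite crit mulr0.
  by ring.
by lra.
Qed.

End drift.

(** * Strict inequalities between Gaussian expectations *)

Section positivity.
Context {R : realType}.
Implicit Types (f : R -> R) (a b c x y z s t : R).
Local Notation mu := (@lebesgue_measure R).

Lemma gaussE_gt0 f a b : a < b -> quad_growth f -> (forall z, 0 <= f z) ->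
  (forall z, a <= z <= b -> 0 < f z) -> 0 < gaussE f.
Proof.
move=> ab qf f0 fab; have [cf _] := qf.
have cfp : continuous (fun z => f z * phi z).
  by move=> z; apply: cvgM; [exact: cf|exact: continuous_phi].
have [|c cab cmin] := @EVT_min _ (fun z => f z * phi z) a b (ltW ab).
  exact: continuous_subspaceT.
set m := f c * phi c in cmin.
have m0 : 0 < m.
  by rewrite mulr_gt0 ?phi_gt0 // fab // -in_itv.
have intfp := integrable_mul_phi qf.
have intab : mu.-integrable `[a, b] (fun z => (f z * phi z)%:E).
  by apply: integrableS intfp.
rewrite gaussE_density //; apply: (@lt_le_trans _ _ (m * (b - a))).
  by rewrite mulr_gt0 // subr_gt0.
apply: (@le_trans _ _ (\int[mu]_(z in `[a, b]) (f z * phi z))).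
  have mab : mu `[a, b] = (b - a)%:E.
    by rewrite lebesgue_measure_itv /= lte_fin ab EFinB.
  apply: (@le_trans _ _ (\int[mu]_(z in `[a, b]) m)).
    by rewrite Rintegral_cst //= mab.
  apply: le_Rintegral => //.
  apply/integrableP; split; first exact/measurable_EFinP.
  by rewrite (eq_integral (cst `|m|%:E)) ?integral_cst //= mab ltry.
rewrite /Rintegral fine_le //.
- exact: integrable_fin_num.
- exact: integrable_fin_num.
- apply: ge0_subset_integral => //.
  + by case/integrableP: intfp.
  + by move=> z _; rewrite lee_fin mulr_ge0 // ltW // phi_gt0.
Qed.

Lemma lt_gaussE f g : quad_growth f -> quad_growth g ->
  (forall z, f z <= g z) -> (forall z, 0 < z -> f z < g z) -> gaussE f < gaussE g.
Proof.
move=> qf qg fg fg0; rewrite -subr_gt0 -gaussEB //.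
apply: (@gaussE_gt0 _ 1 2); first by lra.
- exact: quad_growthB.
- by move=> z; rewrite subr_ge0.
- by move=> z /andP[z1 _]; rewrite subr_gt0 fg0 //; lra.
Qed.

End positivity.

(** * Hyperbolic tangent *)

Section hyperbolic_tangent.
Context {R : realType}.
Implicit Types (x y z s t : R).

Let den_gt0 x : 0 < expR x + expR (- x).
Proof. by rewrite addr_gt0 ?expR_gt0. Qed.

Lemma has_deriv_tanh x : has_deriv tanh x (1 - tanh x ^+ 2).
Proof.
have dN := has_deriv_exp (has_derivN (has_deriv_id x)).
have dE := has_deriv_exp (has_deriv_id x).
apply: has_deriv_eq.
  exact: (@has_deriv_div _ _ (fun y => expR y + expR (- y)) _ _ _
    (lt0r_neq0 (den_gt0 x)) (has_derivB dE dN) (has_derivD dE dN)).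
rewrite /tanh /=; have := lt0r_neq0 (den_gt0 x).
by move: (expR x) (expR (- x)) => a b ab; field.
Qed.

Lemma tanhN x : tanh (- x) = - tanh x.
Proof. by rewrite /tanh opprK -[X in X / _]opprB mulNr [X in _ / X]addrC. Qed.

Lemma tanh0 : tanh 0 = 0 :> R.
Proof. by rewrite /tanh oppr0 subrr mul0r. Qed.

Lemma tanh_lt1 x : tanh x < 1.
Proof.
rewrite /tanh ltr_pdivrMr // mul1r; have := expR_gt0 (- x); lra.
Qed.

Lemma tanh_gtN1 x : - 1 < tanh x.
Proof. by have := tanh_lt1 (- x); rewrite tanhN; lra. Qed.

Lemma tanh_sqr_lt1 x : tanh x ^+ 2 < 1.
Proof. by have := tanh_lt1 x; have := tanh_gtN1 x; nra. Qed.

Lemma tanh_increasing x y : x < y -> tanh x < tanh y.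
Proof.
move=> xy; apply: (increasing_derive xy (fun z _ => has_deriv_tanh z)) => z _.
by rewrite subr_gt0 tanh_sqr_lt1.
Qed.

Lemma tanh_tail x : 0 <= x -> x * (1 - tanh x) <= 1.
Proof.
move=> x0; have -> : x * (1 - tanh x) = (2 * x * expR (- x)) / (expR x + expR (- x)).
  rewrite /tanh; have := lt0r_neq0 (den_gt0 x).
  by move: (expR x) (expR (- x)) => a b ab; field.
rewrite ler_pdivrMr // mul1r expRN.
have := expR_ge1Dx x; set e := expR x => le.
have e0 : 0 < e by lra.
rewrite ler_pdivrMr // [leRHS]mulrDl mulVf ?gt_eqF //; nra.
Qed.

End hyperbolic_tangent.

(** * Monotonicity of the left side *)

Section overlap.
Context {R : realType}.
Implicit Types (x y z s t : R).

(** [P_r] in the parameter [s = sqrt r], in which it is differentiable. *)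
Definition overlap s : R := gaussE (fun z => tanh (s * z) ^+ 2).

Definition tanh_moment s : R := gaussE (fun z => z * tanh (s * z)).

Lemma continuous_tanh_mul s : continuous (fun z => tanh (s * z)).
Proof.
move=> z; apply: has_deriv_continuous.
exact: (has_deriv_comp (has_deriv_tanh _) (has_derivZ s (has_deriv_id z))).
Qed.

Lemma norm_tanh_le1 x : `|tanh x| <= 1.
Proof. by rewrite ler_norml !ltW ?tanh_lt1 ?tanh_gtN1. Qed.

Lemma norm_le_1sqr z : `|z| <= 1 * (1 + z ^+ 2).
Proof.
rewrite mul1r -(real_normK (num_real z)).
by have := sqr_ge0 (`|z| - 1); nra.
Qed.

Lemma quad_growth_norm : quad_growth (fun z : R => `|z|).
Proof.
by split; [exact: norm_continuous|exists 1 => z; rewrite normr_id norm_le_1sqr].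
Qed.

Lemma quad_growth_bounded f c : continuous f -> (forall z, `|f z| <= c) ->
  quad_growth (f : R -> R).
Proof.
move=> cf fc; split => //; exists c => z.
have c0 : 0 <= c by apply: le_trans (fc 0).
by apply: (le_trans (fc z)); rewrite ler_peMr // lerDl sqr_ge0.
Qed.

Lemma quad_growth_cst c : quad_growth (fun=> c : R).
Proof. by apply: (@quad_growth_bounded _ `|c|) => //; exact: cst_continuous. Qed.

Lemma quad_growth_tanh s : quad_growth (fun z => tanh (s * z)).
Proof.
apply: (@quad_growth_bounded _ 1); first exact: continuous_tanh_mul.
by move=> z; exact: norm_tanh_le1.
Qed.

Lemma quad_growth_tanh_sqr s : quad_growth (fun z => tanh (s * z) ^+ 2).
Proof.
apply: (@quad_growth_bounded _ 1).
  by move=> z; apply: cvgM; exact: continuous_tanh_mul.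
by move=> z; rewrite normrX expr_le1 // norm_tanh_le1.
Qed.

Lemma quad_growth_mul_tanh s : quad_growth (fun z => z * tanh (s * z)).
Proof.
split; first by move=> z; apply: cvgM; [exact: cvg_id|exact: continuous_tanh_mul].
exists 1 => z; rewrite normrM; apply: le_trans (norm_le_1sqr z).
by rewrite ler_piMr // norm_tanh_le1.
Qed.

(** Gaussian integration by parts against [tanh (s z)]. This turns the quantity
    on the left, whose dependence on [s] is unclear, into an expectation that is
    increasing in [s] before integration. *)
Lemma overlap_moment s : s * (1 - overlap s) = tanh_moment s.
Proof.
have q1 := @quad_growth_cst 1; have qt := quad_growth_tanh_sqr s.
rewrite /tanh_moment (@gaussE_stein _ _ (fun z => s * (1 - tanh (s * z) ^+ 2))).
- rewrite gaussEZ ?gaussEB //; last exact: quad_growthB.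
  by rewrite gaussE_cst.
- move=> z; apply: has_deriv_eq.
    exact: (has_deriv_comp (has_deriv_tanh _) (has_derivZ s (has_deriv_id z))).
  by rewrite mulr1 mulrC.
- exact: quad_growth_tanh.
- exact/quad_growthZ/quad_growthB.
- exact: quad_growth_mul_tanh.
Qed.

Lemma mul_tanhE s z : z * tanh (s * z) = `|z| * tanh (s * `|z|).
Proof.
have [z0|z0] := leP 0 z; first by rewrite ger0_norm.
by rewrite ltr0_norm // mulrN tanhN mulrNN.
Qed.

Lemma tanh_moment_increasing s t : s < t -> tanh_moment s < tanh_moment t.
Proof.
move=> st; apply: lt_gaussE; try exact: quad_growth_mul_tanh.
- move=> z; rewrite (mul_tanhE s) (mul_tanhE t) ler_wpM2l //.
  have := normr_ge0 z; rewrite le_eqVlt => /predU1P[<-|z0]; first by rewrite !mulr0.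
  by rewrite ltW // tanh_increasing // ltr_pM2r.
- by move=> z z0; rewrite ltr_pM2l // tanh_increasing // ltr_pM2r.
Qed.

Lemma tanh_moment_lt s : tanh_moment s < 2 * phi 0.
Proof.
rewrite -gaussE_norm; apply: lt_gaussE => [| |z|z z0].
- exact: quad_growth_mul_tanh.
- exact: quad_growth_norm.
- by rewrite mul_tanhE ler_piMr // ltW // tanh_lt1.
- by rewrite mul_tanhE (gtr0_norm z0) -[ltRHS]mulr1 ltr_pM2l // tanh_lt1.
Qed.

(** [|z| - z tanh (s z) = |z| (1 - tanh (s |z|)) <= 1 / s]. *)
Lemma tanh_moment_ge s : 0 < s -> 2 * phi 0 - s^-1 <= tanh_moment s.
Proof.
move=> s0; have qn := @quad_growth_norm; have qc := @quad_growth_cst s^-1.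
rewrite -gaussE_norm -[s^-1]gaussE_cst -gaussEB //; apply: le_gaussE.
- exact: quad_growthB.
- exact: quad_growth_mul_tanh.
move=> z; rewrite mul_tanhE lerBlDr -lerBlDl -{1}[`|z|]mulr1 -mulrBr.
rewrite -[leRHS]mul1r ler_pdivlMr // mulrAC [`|z| * s]mulrC.
by rewrite tanh_tail // mulr_ge0 // ltW.
Qed.

Lemma tanh_moment_gt0 s : 0 < s -> 0 < tanh_moment s.
Proof.
move=> s0; apply: (@gaussE_gt0 _ _ 1 2); first by lra.
- exact: quad_growth_mul_tanh.
- move=> z; rewrite mul_tanhE mulr_ge0 //.
  have := normr_ge0 z; rewrite le_eqVlt => /predU1P[<-|z0].
    by rewrite mulr0 tanh0.
  by rewrite -tanh0 ltW // tanh_increasing // mulr_gt0.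
- move=> z /andP[z1 _]; have z0 : 0 < z by lra.
  by rewrite mulr_gt0 // -tanh0 tanh_increasing // mulr_gt0.
Qed.

Lemma overlap_lt1 s : 0 < s -> overlap s < 1.
Proof.
move=> s0; have := tanh_moment_gt0 s0.
by rewrite -overlap_moment pmulr_rgt0 // subr_gt0.
Qed.

Lemma overlap_gt0 s : 0 < s -> 0 < overlap s.
Proof.
move=> s0; apply: (@gaussE_gt0 _ _ 1 2); first by lra.
- exact: quad_growth_tanh_sqr.
- by move=> z; exact: sqr_ge0.
- move=> z /andP[z1 _]; have z0 : 0 < z by lra.
  by rewrite exprn_gt0 // -tanh0 tanh_increasing // mulr_gt0.
Qed.

Lemma overlap0 : overlap 0 = 0.
Proof.
rewrite /overlap; under eq_fun do rewrite mul0r tanh0 expr0n /=.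
exact: gaussE_cst.
Qed.

Lemma continuous_overlap : continuous overlap.
Proof.
move=> s; apply: has_deriv_continuous.
apply: (@gaussE_has_deriv _ (fun s z => tanh (s * z) ^+ 2)
   (fun s z => 2 * tanh (s * z) * ((1 - tanh (s * z) ^+ 2) * z)) s (s - 1) (s + 1) 2).
- by apply/andP; split; lra.
- by move=> t _; exact: quad_growth_tanh_sqr.
- move=> t z _; apply: has_deriv_sqr; apply: has_deriv_eq.
    apply: (has_deriv_comp (has_deriv_tanh _)).
    exact: (has_derivM (has_deriv_id t) (has_deriv_cst z t)).
  by rewrite mul1r mulr0 addr0.
- move=> t z _; rewrite (normrM (2 * _)) (normrM 2) (normrM _ z).
  rewrite ger0_norm // -!mulrA ler_wpM2l //.
  rewrite -[leRHS]mul1r; apply: (le_trans _ (norm_le_1sqr z)).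
  rewrite mulrA ler_piMl // mulr_ile1 //.
    exact: norm_tanh_le1.
  have := sqr_ge0 (tanh (t * z)); have := tanh_sqr_lt1 (t * z).
  by move=> lt1 ge0; rewrite ger0_norm; lra.
Qed.

End overlap.

(** * Growth of the inverse Mills ratio *)

Section growth.
Context {R : realType}.
Implicit Types (f : R -> R) (u x z a b c : R).

Lemma invMills_ge_pos u : Num.max u 0 <= invMills u.
Proof. by rewrite ge_max !ltW // ?invMills_gt0 // invMills_gt. Qed.

Lemma invMills_le_pos u : invMills u <= Num.max u 0 + 1.
Proof.
have e01 := @invMills0_le1 R.
have [u0|u0] := leP u 0.
  by rewrite add0r (le_trans (invMills_nondecreasing u0)).
suff : invMills u - u <= invMills 0 - 0 by lra.
rewrite -lerN2.
apply: (nondecreasing_derive (ltW u0) (f := fun x => - (invMills x - x))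
  (f' := fun x => - (invMills x * (invMills x - x) - 1))) => x _.
  exact: (has_derivN (has_derivB (has_deriv_invMills x) (has_deriv_id x))).
by rewrite oppr_ge0 subr_le0 invMills_slope_le1.
Qed.

Lemma invMills_le_norm u : invMills u <= 1 + `|u|.
Proof.
apply: (le_trans (invMills_le_pos u)); rewrite addrC lerD2l ge_max normr_ge0 andbT.
exact: ler_norm.
Qed.

Lemma sqr1norm_le z : (1 + `|z|) ^+ 2 <= 2 * (1 + z ^+ 2).
Proof. by rewrite -(real_normK (num_real z)); have := sqr_ge0 (`|z| - 1); nra. Qed.

Lemma continuous_affine a b : continuous (fun z : R => a - b * z).
Proof.
move=> z; apply: has_deriv_continuous.
exact: (has_derivB (has_deriv_cst a z) (has_derivZ b (has_deriv_id z))).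
Qed.

Lemma quad_growth_affine f a b : quad_growth f ->
  quad_growth (fun z => f (a - b * z)).
Proof.
move=> [cf [K fK]]; split.
  by move=> z; apply: continuous_comp; [exact: continuous_affine|exact: cf].
have K0 : 0 <= K by have := fK 0; rewrite expr0n addr0 mulr1; apply: le_trans.
exists (K * (1 + 2 * a ^+ 2 + 2 * b ^+ 2)) => z.
apply: (le_trans (fK _)); rewrite -mulrA ler_wpM2l //.
have := sqr_ge0 (a + b * z); have := sqr_ge0 (a * z).
have := sqr_ge0 b; have := sqr_ge0 z.
by nra.
Qed.

Lemma norm_affine_le a b z : 1 + `|a - b * z| <= (1 + `|a| + `|b|) * (1 + `|z|).
Proof.
have := ler_normB a (b * z); rewrite normrM.
have := normr_ge0 a; have := normr_ge0 b; have := normr_ge0 z; nra.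
Qed.

Lemma quad_growth_mul_affine f a b K : continuous f ->
  (forall u, `|f u| <= K * (1 + `|u|)) ->
  quad_growth (fun z => z * f (a - b * z)).
Proof.
move=> cf fK; have K0 : 0 <= K.
  by have := fK 0; rewrite normr0 addr0 mulr1; apply: le_trans.
split.
  move=> z; apply: cvgM; first exact: cvg_id.
  by apply: continuous_comp; [exact: continuous_affine|exact: cf].
exists (K * (1 + `|a| + `|b|) * 2) => z.
rewrite normrM; apply: (le_trans (ler_wpM2l (normr_ge0 z) (fK _))).
rewrite -!mulrA mulrCA ler_wpM2l //.
have z0 := normr_ge0 z; have C0 : 0 <= 1 + `|a| + `|b| by rewrite !addr_ge0.
apply: (@le_trans _ _ ((1 + `|a| + `|b|) * (1 + `|z|) ^+ 2)).
  have := norm_affine_le a b z; set c := 1 + `|a| + `|b| in C0 *; nra.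
by rewrite ler_wpM2l // sqr1norm_le.
Qed.

End growth.

Section mills_flow.
Context {R : realType}.
Implicit Types (u x z s kappa : R).

(** [e e'], half of the derivative of [e^2]. *)
Definition mills_flux u : R := invMills u * (invMills u * (invMills u - u)).

Definition mills_flux' u : R :=
  (invMills u * (invMills u - u)) ^+ 2 +
  invMills u * (invMills u * (invMills u - u) * (2 * invMills u - u) - invMills u).

Lemma has_deriv_mills_flux u : has_deriv mills_flux u (mills_flux' u).
Proof.
have de := has_deriv_invMills u.
apply: has_deriv_eq.
  exact: (has_derivM de (has_derivM de (has_derivB de (has_deriv_id u)))).
by rewrite /mills_flux'; ring.
Qed.

(** The form in which [drift] comes out of the differentiation of [energy]. *)
Lemma driftE u : drift u = mills_flux u * u + mills_flux' u - invMills u ^+ 2.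
Proof. by rewrite /drift /mills_flux /mills_flux'; ring. Qed.

Lemma invMills_slope_ge0 u : 0 <= invMills u * (invMills u - u).
Proof. by rewrite mulr_ge0 // ?subr_ge0 ltW ?invMills_gt0 // invMills_gt. Qed.

Lemma mills_flux_le u : `|mills_flux u| <= 1 * (1 + `|u|).
Proof.
have k0 := invMills_slope_ge0 u; have k1 := invMills_slope_le1 u.
have e0 := invMills_gt0 u; have e1 := invMills_le_norm u.
rewrite /mills_flux (ger0_norm (mulr_ge0 (ltW e0) k0)) mul1r.
by apply: le_trans e1; rewrite ler_piMr // ltW.
Qed.

Lemma continuous_invMills : continuous (@invMills R).
Proof. by move=> u; exact: has_deriv_continuous (has_deriv_invMills u). Qed.

Lemma continuous_mills_flux : continuous mills_flux.
Proof. by move=> u; exact: has_deriv_continuous (has_deriv_mills_flux u). Qed.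

Lemma quad_growth_invMills_sqr : quad_growth (fun u => invMills u ^+ 2 : R).
Proof.
split; first by move=> u; apply: cvgM; exact: continuous_invMills.
exists 2 => u; have e0 := invMills_gt0 u; have e1 := invMills_le_norm u.
rewrite ger0_norm ?sqr_ge0 //; apply: le_trans (sqr1norm_le u).
by rewrite ler_sqr ?nnegrE ?(ltW e0) ?addr_ge0.
Qed.

Lemma quad_growth_mills_flux : quad_growth mills_flux.
Proof.
split; first exact: continuous_mills_flux.
exists 2 => u; apply: (le_trans (mills_flux_le u)).
by rewrite mul1r -(real_normK (num_real u)); have := sqr_ge0 (`|u| - 1); nra.
Qed.

Lemma quad_growth_mills_flux_mul : quad_growth (fun u => mills_flux u * u).
Proof.
have := quad_growth_mul_affine 0 (- 1) continuous_mills_flux mills_flux_le.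
by congr quad_growth; apply/funext => u; rewrite mulN1r sub0r opprK mulrC.
Qed.

Lemma quad_growth_mills_flux' : quad_growth mills_flux'.
Proof.
split.
  have c := @continuous_invMills.
  have ck : continuous (fun u : R => invMills u * (invMills u - u)).
    by move=> u; apply: cvgM; [exact: c|apply: cvgB; [exact: c|exact: cvg_id]].
  move=> u; apply: cvgD; first by apply: cvgM; exact: ck.
  apply: cvgM; first exact: c.
  apply: cvgB; last exact: c.
  apply: cvgM; first exact: ck.
  by apply: cvgB; [apply: cvgM; [exact: cvg_cst|exact: c]|exact: cvg_id].
exists 8 => u; have e0 := invMills_gt0 u; have e1 := invMills_le_norm u.
have k0 := invMills_slope_ge0 u; have k1 := invMills_slope_le1 u.
have ey := invMills_gt u.
have eN := sqr1norm_le u.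
have e2 : invMills u ^+ 2 <= 2 * (1 + u ^+ 2).
  by apply: le_trans eN; rewrite ler_sqr ?nnegrE ?(ltW e0) ?addr_ge0.
have u2 := sqr_ge0 u.
rewrite /mills_flux'; move: (invMills u) e0 e2 ey k0 k1 => e e0 e2 ey k0 k1.
have -> : (e * (e - u)) ^+ 2 + e * (e * (e - u) * (2 * e - u) - e) =
    2 * (e * (e - u)) ^+ 2 + e ^+ 2 * (e * (e - u)) - e ^+ 2 by ring.
move: (e * (e - u)) k0 k1 => k k0 k1.
have k2 : 0 <= k ^+ 2 <= 1 by rewrite sqr_ge0 expr_le1.
have ke : 0 <= e ^+ 2 * k <= e ^+ 2.
  by rewrite mulr_ge0 ?sqr_ge0 //= ler_piMr // sqr_ge0.
rewrite ler_norml; lra.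
Qed.

End mills_flow.

(** * Monotonicity of the right side *)

Section energy.
Context {R : realType}.
Implicit Types (u x z s a kappa : R).

(** The argument [(kappa - sqrt q z) / sqrt (1 - q)] of the inverse Mills ratio in
    [F_q], in terms of [s = sqrt (q / (1 - q))]. This parameter makes it affine in
    [z] with slope [s], and smooth in [s]. *)
Definition field_at kappa s z : R := kappa * Num.sqrt (s ^+ 2 + 1) - s * z.

(** [(1 - q)^2 E F_q(sqrt q Z)^2] in terms of [s = sqrt (q / (1 - q))], for which
    [1 - q = 1 / (s^2 + 1)]. *)
Definition energy kappa s : R :=
  gaussE (fun z => invMills (field_at kappa s z) ^+ 2) / (s ^+ 2 + 1).

(** For [z <= 0] the argument of [drift] is nonnegative because [kappa >= 0].
    Pairing [z] with [-z], at least one of the two values of [drift] is at most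
    [-1/20], and the other one is at most [1/20]. *)
Lemma mean_drift_le0 kappa s : 0 <= kappa -> 0 <= s ->
  gaussE (fun z => drift (field_at kappa s z)) <= 0.
Proof.
move=> k0 s0.
have qd : quad_growth (fun z => drift (field_at kappa s z)).
  apply: quad_growth_affine.
  rewrite (_ : drift = fun u => mills_flux u * u + mills_flux' u - invMills u ^+ 2);
    last by apply/funext => u; exact: driftE.
  apply: quad_growthB; last exact: quad_growth_invMills_sqr.
  apply: quad_growthD; first exact: quad_growth_mills_flux_mul.
  exact: quad_growth_mills_flux'.
have qdN : quad_growth (fun z => drift (field_at kappa s (- z))).
  have := quad_growth_affine 0 1 qd.
  by congr quad_growth; apply/funext => z; rewrite mul1r sub0r.
have right z : z <= 0 -> drift (field_at kappa s z) <= - 20^-1.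
  move=> z0; apply: drift_le_right; rewrite /field_at.
  have := mulr_ge0 k0 (sqrtr_ge0 (s ^+ 2 + 1)); nra.
have any u : drift u <= 20^-1.
  by have [/drift_le_left//|/ltW/drift_le_right] := leP u 0; lra.
have : gaussE (fun z =>
    drift (field_at kappa s z) + drift (field_at kappa s (- z))) <= 0.
  rewrite -[leRHS](gaussE_cst 0); apply: le_gaussE.
  - exact: quad_growthD.
  - exact: quad_growth_cst.
  move=> z; have [/right|z0] := leP z 0.
    by have := any (field_at kappa s (- z)); lra.
  have : drift (field_at kappa s (- z)) <= - 20^-1.
    by apply: right; rewrite oppr_le0 ltW.
  by have := any (field_at kappa s z); lra.
rewrite gaussED // (gaussE_opp qd); lra.
Qed.

Lemma energy_integrand_bound kappa a s z : 0 <= kappa -> a - 1 < s < a + 1 ->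
  `|2 * (mills_flux (field_at kappa s z) * (kappa * (s / Num.sqrt (s ^+ 2 + 1)) - z))|
  <= 4 * (1 + (kappa * (`|a| + 2) + (`|a| + 1))) * (1 + kappa) * (1 + z ^+ 2).
Proof.
move=> k0 sa; have l0 : 0 < 1 :> R by [].
have sS := lt_sqrt_sqrD s l0; have S2 := sqr_sqrt_sqrD s l0.
have s1 : `|s| <= `|a| + 1.
  rewrite -[s](subrK a) addrC (le_trans (ler_normD _ _)) // lerD2l ler_norml; lra.
have flux := mills_flux_le (field_at kappa s z); rewrite mul1r in flux.
have a0 := normr_ge0 a; have z0 := normr_ge0 z; have s0 := normr_ge0 s.
rewrite (normrM 2) (normrM (mills_flux _)) (ger0_norm (ler0n _ 2)).
move: sS S2 flux; rewrite /field_at; set S := Num.sqrt _ => sS S2 flux.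
have S0 : 0 < S by apply: le_lt_trans sS.
have S1 : S <= `|a| + 2.
  have : S ^+ 2 <= (`|s| + 1) ^+ 2.
    by rewrite S2 -(real_normK (num_real s)); nra.
  by rewrite ler_sqr ?nnegrE ?(ltW S0) ?addr_ge0 //; lra.
set C := 1 + (kappa * (`|a| + 2) + (`|a| + 1)).
have C1 : 1 <= C by rewrite lerDl addr_ge0 ?mulr_ge0 ?addr_ge0.
have U1 : `|mills_flux (kappa * S - s * z)| <= C * (1 + `|z|).
  apply: (le_trans flux); apply: (le_trans (norm_affine_le _ _ _)).
  rewrite ler_wpM2r ?addr_ge0 // /C normrM (ger0_norm k0) (gtr0_norm S0).
  by rewrite -addrA lerD2l lerD // ler_wpM2l.
have V1 : `|kappa * (s / S) - z| <= (1 + kappa) * (1 + `|z|).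
  apply: (le_trans (ler_normB _ _)).
  have : `|kappa * (s / S)| <= kappa.
    rewrite (normrM kappa) (ger0_norm k0) ler_piMr // (normrM s) normfV (gtr0_norm S0).
    by rewrite ler_pdivrMr // mul1r ltW.
  by nra.
have h := sqr1norm_le z.
apply: (@le_trans _ _ (2 * ((C * (1 + `|z|)) * ((1 + kappa) * (1 + `|z|))))).
  by rewrite ler_wpM2l // ler_pM.
have -> : 2 * (C * (1 + `|z|) * ((1 + kappa) * (1 + `|z|))) =
  2 * (C * (1 + kappa)) * (1 + `|z|) ^+ 2 by ring.
have -> : 4 * C * (1 + kappa) * (1 + z ^+ 2) =
  2 * (C * (1 + kappa)) * (2 * (1 + z ^+ 2)) by ring.
have C0 : 0 <= C := le_trans ler01 C1.
by rewrite ler_wpM2l // mulr_ge0 // mulr_ge0 // addr_ge0.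
Qed.

(** Differentiation under the expectation produces a term in [z e e'(U)]; Stein's
    lemma replaces the factor [z] by a derivative of [e e'], and the terms combine
    into [drift]. *)
Lemma has_deriv_energy kappa a : 0 <= kappa -> has_deriv (energy kappa) a
  (2 * a / (a ^+ 2 + 1) ^+ 2 * gaussE (fun z => drift (field_at kappa a z))).
Proof.
move=> k0; have l0 : 0 < 1 :> R by [].
pose S s : R := Num.sqrt (s ^+ 2 + 1).
have S0 s : 0 < S s by rewrite sqrtr_gt0 ltr_wpDl ?sqr_ge0.
have S2 s : S s ^+ 2 = s ^+ 2 + 1 by exact: sqr_sqrt_sqrD.
pose U s z := field_at kappa s z.
have dU s z : has_deriv (U ^~ z) s (kappa * (s / S s) - z).
  apply: has_deriv_eq.
    apply: (has_derivB (has_derivZ kappa (has_deriv_sqrt_sqrD s l0))).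
    exact: (has_derivM (has_deriv_id s) (has_deriv_cst z s)).
  by rewrite mul1r mulr0 addr0.
have qe s : quad_growth (fun z => invMills (U s z) ^+ 2).
  exact: (quad_growth_affine _ _ quad_growth_invMills_sqr).
have dM : has_deriv (fun s => gaussE (fun z => invMills (U s z) ^+ 2)) a
    (gaussE (fun z => 2 * (mills_flux (U a z) * (kappa * (a / S a) - z)))).
  pose K := 4 * (1 + (kappa * (`|a| + 2) + (`|a| + 1))) * (1 + kappa).
  apply: (@gaussE_has_deriv _ (fun s z => invMills (U s z) ^+ 2)
    (fun s z => 2 * (mills_flux (U s z) * (kappa * (s / S s) - z)))
    a (a - 1) (a + 1) K).
  - by apply/andP; split; lra.
  - by move=> s _; exact: qe.
  - move=> s z _; apply: has_deriv_eq.
      exact: (has_deriv_sqr (has_deriv_comp (has_deriv_invMills _) (dU s z))).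
    by rewrite /mills_flux; ring.
  - move=> s z sa; exact: energy_integrand_bound.
have qg := quad_growth_affine (kappa * S a) a quad_growth_mills_flux.
have qgu := quad_growth_affine (kappa * S a) a quad_growth_mills_flux_mul.
have qg' := quad_growth_affine (kappa * S a) a quad_growth_mills_flux'.
have qzg := quad_growth_mul_affine (kappa * S a) a continuous_mills_flux mills_flux_le.
set Eg := gaussE (fun z => mills_flux (kappa * S a - a * z)).
set Eg' := gaussE (fun z => mills_flux' (kappa * S a - a * z)).
have stein : gaussE (fun z => z * mills_flux (kappa * S a - a * z)) = - a * Eg'.
  have dg z : has_deriv (fun z => mills_flux (kappa * S a - a * z)) z
      (- a * mills_flux' (kappa * S a - a * z)).
    apply: has_deriv_eq.
      apply: (has_deriv_comp (has_deriv_mills_flux _)).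
      exact: (has_derivB (has_deriv_cst (kappa * S a) z)
        (has_derivZ a (has_deriv_id z))).
    by ring.
  by rewrite (gaussE_stein dg qg (quad_growthZ _ qg') qzg) gaussEZ.
have ME : gaussE (fun z => 2 * (mills_flux (U a z) * (kappa * (a / S a) - z))) =
    2 * (kappa * (a / S a)) * Eg + 2 * a * Eg'.
  transitivity (gaussE (fun z =>
      2 * (kappa * (a / S a)) * mills_flux (kappa * S a - a * z)
      - 2 * (z * mills_flux (kappa * S a - a * z)))).
    by congr gaussE; apply/funext => z; rewrite /U /field_at -/(S a); ring.
  have q1 := quad_growthZ (2 * (kappa * (a / S a))) qg.
  have q2 := quad_growthZ 2 qzg.
  by rewrite (gaussEB q1 q2) (gaussEZ _ qg) (gaussEZ _ qzg) stein -/Eg; ring.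
have DE : gaussE (fun z => drift (field_at kappa a z)) =
    kappa * S a * Eg + (a ^+ 2 + 1) * Eg' - gaussE (fun z => invMills (U a z) ^+ 2).
  transitivity (gaussE (fun z => kappa * S a * mills_flux (kappa * S a - a * z)
      - a * (z * mills_flux (kappa * S a - a * z))
      + mills_flux' (kappa * S a - a * z) - invMills (U a z) ^+ 2)).
    by congr gaussE; apply/funext => z; rewrite driftE /U /field_at -/(S a); ring.
  have q1 := quad_growthZ (kappa * S a) qg; have q2 := quad_growthZ a qzg.
  have q3 := quad_growthB q1 q2.
  rewrite (gaussEB (quad_growthD q3 qg') (qe a)) (gaussED q3 qg') (gaussEB q1 q2).
  by rewrite (gaussEZ _ qg) (gaussEZ _ qzg) stein -/Eg -/Eg'; ring.
have n0 : a ^+ 2 + 1 != 0 by rewrite gt_eqF // ltr_wpDl ?sqr_ge0.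
have dn : has_deriv (fun s => s ^+ 2 + 1) a (2 * a).
  apply: has_deriv_eq.
    exact: (has_derivD (has_deriv_sqr (has_deriv_id a)) (has_deriv_cst 1 a)).
  by rewrite mulr1 addr0.
apply: (has_deriv_eq (@has_deriv_div _ _ (fun s => s ^+ 2 + 1) _ _ _ n0 dM dn)).
rewrite ME DE; have -> : a / S a = a * S a / (a ^+ 2 + 1).
  by rewrite -S2; field; rewrite gt_eqF.
move: (S a) (gaussE (fun z => invMills (U a z) ^+ 2)) => t M.
by field.
Qed.

End energy.

(** * The limit of the right side *)

Section energy_limit.
Context {R : realType}.
Implicit Types (u x z s t a kappa : R).

Lemma energy_nonincreasing kappa s t : 0 <= kappa -> 0 <= s -> s <= t ->
  energy kappa t <= energy kappa s.
Proof.
move=> k0 s0 st; rewrite -lerN2.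
apply: (nondecreasing_derive st (f := fun a => - energy kappa a)
  (fun a _ => has_derivN (has_deriv_energy a k0))) => a /andP[sa _].
have a0 := le_trans s0 sa.
rewrite oppr_ge0 mulr_ge0_le0 ?mean_drift_le0 //.
by rewrite divr_ge0 ?sqr_ge0 // mulr_ge0.
Qed.

Lemma quad_growth_hinge kappa : quad_growth (fun z => Num.max (kappa - z) 0 ^+ 2).
Proof.
have cm : continuous (fun z => Num.max (kappa - z) 0).
  move=> z; apply: (@continuous_max _ _ (fun z => kappa - z) (fun=> 0)).
    by apply: cvgB; [exact: cvg_cst|exact: cvg_id].
  exact: cvg_cst.
split; first by move=> z; apply: cvgM; exact: cm.
exists (2 * (1 + kappa ^+ 2)) => z.
rewrite ger0_norm ?sqr_ge0 //; apply: (@le_trans _ _ ((kappa - z) ^+ 2)).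
  by case: (leP (kappa - z) 0) => _; rewrite ?expr0n /= ?sqr_ge0.
have := sqr_ge0 (kappa + z); have := sqr_ge0 (kappa * z); nra.
Qed.

Lemma C_kappa_gt0 kappa : 0 <= kappa -> 0 < C_kappa kappa.
Proof.
move=> k0; apply: (@gaussE_gt0 _ _ (-2) (-1)); first by lra.
- exact: quad_growth_hinge.
- by move=> z; exact: sqr_ge0.
- by move=> z /andP[_ z1]; rewrite exprn_gt0 // lt_max; apply/orP; left; lra.
Qed.

Lemma hinge_lipschitz x y : `|Num.max x 0 - Num.max y 0| <= `|x - y|.
Proof.
rewrite ler_norml; have := ler_norm (x - y); have := ler_norm (- (x - y)).
rewrite normrN.
by case: (leP x 0); case: (leP y 0) => ? ? ? ?; apply/andP; split; lra.
Qed.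

(** With [t = 1 / sqrt (s^2 + 1)], the integrand of [energy] is the square of
    [t e(U)], which is within [t] of [(t U)_+] because [u_+ <= e(u) <= u_+ + 1];
    and [t U = kappa - t s z] is within [t |z|] of [kappa - z]. *)
Lemma energy_integrand_dist kappa s z : 0 <= kappa -> 0 <= s ->
  `|invMills (field_at kappa s z) ^+ 2 / (s ^+ 2 + 1) - Num.max (kappa - z) 0 ^+ 2|
  <= (Num.sqrt (s ^+ 2 + 1))^-1 * (2 * (2 * kappa + 3)) * (1 + z ^+ 2).
Proof.
move=> k0 s0; have l0 : 0 < 1 :> R by [].
have := lt_sqrt_sqrD s l0; have := sqr_sqrt_sqrD s l0; rewrite ger0_norm // /field_at.
set S := Num.sqrt _ => S2 sS.
have S0 : 0 < S by apply: le_lt_trans sS.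
have S1 : 1 <= S by nra.
rewrite -S2; set t := S^-1; set U := kappa * S - s * z.
have t0 : 0 < t by rewrite invr_gt0.
have t1 : t <= 1 by rewrite invf_le1.
have tS : t * S = 1 by rewrite mulVf // gt_eqF.
have -> : invMills U ^+ 2 / S ^+ 2 = (t * invMills U) ^+ 2.
  by rewrite /t; field; rewrite gt_eqF.
set h := t * invMills U; set m := Num.max (kappa - z) 0.
have wE : t * U = kappa - t * s * z by rewrite /U; nra.
have maxE : t * Num.max U 0 = Num.max (t * U) 0.
  by rewrite (maxr_pMr _ _ (ltW t0)) mulr0.
have h1 : Num.max (t * U) 0 <= h.
  by rewrite -maxE /h ler_wpM2l ?invMills_ge_pos // ltW.
have h2 : h <= Num.max (t * U) 0 + t.
  by rewrite -maxE /h -[X in _ <= _ + X]mulr1 -mulrDr ler_wpM2l ?invMills_le_pos // ltW.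
have z0 := normr_ge0 z.
have ts : 0 <= 1 - t * s <= t by apply/andP; split; nra.
have wm : `|Num.max (t * U) 0 - m| <= t * `|z|.
  apply: (le_trans (hinge_lipschitz _ _)).
  rewrite wE (_ : _ - _ - _ = (1 - t * s) * z); last by ring.
  by case/andP: ts => ts0 ts1; rewrite normrM (ger0_norm ts0) ler_wpM2r.
have hm : `|h - m| <= t * (1 + `|z|).
  by move: wm; rewrite !ler_norml => /andP[? ?]; apply/andP; split; lra.
have m0 : 0 <= m by rewrite le_max lexx orbT.
have m1 : m <= kappa + `|z|.
  rewrite ge_max addr_ge0 // andbT lerD2l -normrN ler_norm //.
have h0 : 0 <= h by rewrite mulr_ge0 // ltW // invMills_gt0.
have hm' : h + m <= (2 * kappa + 3) * (1 + `|z|).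
  by move: hm; rewrite ler_norml => /andP[_ ?]; nra.
rewrite subr_sqr normrM (ger0_norm (addr_ge0 h0 m0)).
apply: (@le_trans _ _ (t * (1 + `|z|) * ((2 * kappa + 3) * (1 + `|z|)))).
  by apply: ler_pM => //; exact: addr_ge0.
have -> : t * (1 + `|z|) * ((2 * kappa + 3) * (1 + `|z|)) =
  t * (2 * kappa + 3) * (1 + `|z|) ^+ 2 by ring.
have -> : t * (2 * (2 * kappa + 3)) * (1 + z ^+ 2) =
  t * (2 * kappa + 3) * (2 * (1 + z ^+ 2)) by ring.
by rewrite ler_wpM2l ?sqr1norm_le // mulr_ge0 ?(ltW t0) // addr_ge0 // mulr_ge0.
Qed.

Lemma energy_limit kappa : 0 <= kappa -> exists2 K, 0 <= K & forall s, 0 <= s ->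
  `|energy kappa s - C_kappa kappa| <= K / Num.sqrt (s ^+ 2 + 1).
Proof.
move=> k0; pose c : R := 2 * (2 * kappa + 3).
have c0 : 0 <= c by rewrite /c; lra.
have q1 : quad_growth (fun z : R => 1 + z ^+ 2) by exact: quad_growth_1sqr.
exists (c * gaussE (fun z => 1 + z ^+ 2)).
  rewrite mulr_ge0 // -[leLHS](gaussE_cst 0).
  by apply: le_gaussE => // [|z]; [exact: quad_growth_cst|rewrite addr_ge0 // sqr_ge0].
move=> s s0; set t := (Num.sqrt (s ^+ 2 + 1))^-1.
have qe : quad_growth (fun z => (s ^+ 2 + 1)^-1 * invMills (field_at kappa s z) ^+ 2).
  exact/quad_growthZ/(quad_growth_affine _ _ quad_growth_invMills_sqr).
have qh := quad_growth_hinge kappa.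
have qK : quad_growth (fun z : R => t * c * (1 + z ^+ 2)) by exact: quad_growthZ.
have EE : energy kappa s =
    gaussE (fun z => (s ^+ 2 + 1)^-1 * invMills (field_at kappa s z) ^+ 2).
  rewrite gaussEZ 1?mulrC //.
  exact: (quad_growth_affine _ _ quad_growth_invMills_sqr).
have dist z := energy_integrand_dist z k0 s0.
have KE : c * gaussE (fun z => 1 + z ^+ 2) * t = gaussE (fun z => t * c * (1 + z ^+ 2)).
  by rewrite gaussEZ //; ring.
rewrite KE EE /C_kappa ler_norml; apply/andP; split.
- rewrite lerNl opprB -gaussEB //; apply: le_gaussE => //; first exact: quad_growthB.
  by move=> z; have := dist z; rewrite distrC ler_norml => /andP[_]; rewrite mulrC.
- rewrite -gaussEB //; apply: le_gaussE => //; first exact: quad_growthB.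
  by move=> z; have := dist z; rewrite ler_norml => /andP[_]; rewrite mulrC.
Qed.

(** [energy] is nonincreasing with limit [C_kappa]. *)
Lemma energy_ge kappa s : 0 <= kappa -> 0 <= s -> C_kappa kappa <= energy kappa s.
Proof.
move=> k0 s0; rewrite leNgt; apply/negP => Es.
have [K K0 lim] := energy_limit k0.
pose d := C_kappa kappa - energy kappa s; have d0 : 0 < d by rewrite subr_gt0.
pose x := s + (K + 1) / d.
have x0 : 0 <= (K + 1) / d by rewrite divr_ge0 ?(ltW d0) ?addr_ge0.
have sx : s <= x by rewrite lerDl.
have := lim x (le_trans s0 sx); have := energy_nonincreasing k0 s0 sx.
have := lt_sqrt_sqrD x (ltr01 : 0 < 1 :> R); rewrite ger0_norm ?(le_trans s0 sx) //.
set S := Num.sqrt _ => xS Ex.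
have S0 : 0 < S by apply: le_lt_trans xS; exact: le_trans sx.
rewrite ler_norml => /andP[h _]; have : d <= K / S by rewrite /d; lra.
rewrite ler_pdivlMr // leNgt => /negP; apply.
apply: (@lt_le_trans _ _ (K + 1)); first by lra.
rewrite mulrC -ler_pdivrMr //; apply: le_trans (ltW xS); rewrite lerDr //.
Qed.

End energy_limit.

(** * The scalar equation *)

Section fixed_point.
Context {R : realType}.
Implicit Types (q r s t a alpha kappa : R).

(** The parameter [sqrt (q / (1 - q))] of [energy] at [q = overlap s]. *)
Definition snr s : R := Num.sqrt (overlap s) / Num.sqrt (1 - overlap s).

(** [(1 - q)^2] times the difference of the two sides of the second equation, for
    [q = overlap s] and [r = s^2]. *)
Definition gap kappa alpha s : R :=
  tanh_moment s ^+ 2 - alpha * energy kappa (snr s).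

Lemma overlap_nondecreasing s t : 0 <= s -> s <= t -> overlap s <= overlap t.
Proof.
move=> s0 st; apply: le_gaussE; try exact: quad_growth_tanh_sqr.
move=> z.
have E x : tanh (x * z) ^+ 2 = tanh (x * `|z|) ^+ 2.
  have [z0|z0] := leP 0 z; first by rewrite ger0_norm.
  by rewrite ltr0_norm // mulrN tanhN sqrrN.
rewrite (E s) (E t); have z0 := normr_ge0 z.
have tm x y : x <= y -> tanh x <= tanh y :> R.
  by rewrite le_eqVlt => /predU1P[->//|/tanh_increasing/ltW].
rewrite ler_sqr ?nnegrE.
- by apply: tm; rewrite ler_wpM2r.
- by rewrite -tanh0; apply: tm; rewrite mulr_ge0.
- by rewrite -tanh0; apply: tm; rewrite mulr_ge0 // (le_trans s0).
Qed.

Lemma snr_ge0 s : 0 <= snr s.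
Proof. by rewrite divr_ge0 ?sqrtr_ge0. Qed.

Lemma snr_nondecreasing s t : 0 < s -> s <= t -> snr s <= snr t.
Proof.
move=> s0 st; have t0 := lt_le_trans s0 st.
have q := overlap_nondecreasing (ltW s0) st.
have qs := overlap_lt1 s0; have qt := overlap_lt1 t0.
apply: ler_pM; rewrite ?sqrtr_ge0 ?invr_ge0 ?sqrtr_ge0 // ?ler_wsqrtr //.
rewrite lef_pV2 ?posrE ?sqrtr_gt0 ?subr_gt0 // ler_wsqrtr //; lra.
Qed.

Lemma snr_sqr s : 0 < s -> snr s ^+ 2 + 1 = (1 - overlap s)^-1.
Proof.
move=> s0; have q0 := overlap_gt0 s0; have q1 := overlap_lt1 s0.
have q1' : 0 < 1 - overlap s by rewrite subr_gt0.
rewrite exprMn exprVn !sqr_sqrtr ?ltW //; move: (overlap s) q1' => q q1'.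
by field; rewrite gt_eqF.
Qed.

Lemma gap_increasing kappa alpha s t : 0 <= kappa -> 0 <= alpha -> 0 < s -> s < t ->
  gap kappa alpha s < gap kappa alpha t.
Proof.
move=> k0 a0 s0 st; have t0 := lt_trans s0 st; apply: ltr_leB.
  rewrite ltr_sqr ?nnegrE ?(ltW (tanh_moment_gt0 s0)) ?(ltW (tanh_moment_gt0 t0)) //.
  exact: tanh_moment_increasing.
by rewrite ler_wpM2l // energy_nonincreasing ?snr_ge0 // snr_nondecreasing // ltW.
Qed.

Lemma continuous_tanh_moment : continuous (@tanh_moment R).
Proof.
rewrite (_ : tanh_moment = fun s : R => s * (1 - overlap s)); last first.
  by apply/funext => s; rewrite overlap_moment.
move=> s; apply: cvgM; first exact: cvg_id.
by apply: cvgB; [exact: cvg_cst|exact: continuous_overlap].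
Qed.

Lemma continuous_gap kappa alpha s : 0 <= kappa -> 0 < s ->
  {for s, continuous (gap kappa alpha)}.
Proof.
move=> k0 s0; have cq : overlap x @[x --> s] --> overlap s := @continuous_overlap _ s.
have c1q : 1 - overlap x @[x --> s] --> 1 - overlap s.
  by apply: cvgB => //; exact: cvg_cst.
apply: cvgB.
  by apply: cvgM; exact: continuous_tanh_moment.
apply: cvgM; first exact: cvg_cst.
have cs : snr x @[x --> s] --> snr s.
  apply: cvgM; first by apply: (cvg_comp _ _ cq); exact: sqrt_continuous.
  apply: cvgV; first by rewrite gt_eqF // sqrtr_gt0 subr_gt0 overlap_lt1.
  by apply: (cvg_comp _ _ c1q); exact: sqrt_continuous.
apply: (cvg_comp _ _ cs).
exact: (has_deriv_continuous (has_deriv_energy (snr s) k0)).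
Qed.

Lemma R_kappaE kappa alpha s : 0 < s ->
  R_kappa kappa (overlap s) alpha =
  alpha * energy kappa (snr s) / (1 - overlap s) ^+ 2.
Proof.
move=> s0; have q0 := overlap_gt0 s0; have q1 := overlap_lt1 s0.
have p0 : 0 < 1 - overlap s by rewrite subr_gt0.
rewrite /R_kappa /energy snr_sqr // -mulrA; congr (_ * _).
have qe := quad_growth_affine (kappa * Num.sqrt (snr s ^+ 2 + 1)) (snr s)
  quad_growth_invMills_sqr.
transitivity ((1 - overlap s)^-1 *
    gaussE (fun z => invMills (field_at kappa (snr s) z) ^+ 2)); last first.
  by rewrite invrK; field; rewrite gt_eqF.
rewrite -gaussEZ //; congr gaussE; apply/funext => z.
rewrite /F_q exprMn exprVn sqr_sqrtr ?(ltW p0) //; congr (_ * invMills _ ^+ 2).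
rewrite /field_at snr_sqr // sqrtrV ?(ltW p0) // /snr.
by rewrite mulrBl -!mulrA [_^-1 * z]mulrC.
Qed.

(** The point [r = 0] has to be excluded separately: there [q = 0], while
    [R_kappa] is positive. *)
Lemma gap_solution kappa alpha q r : 0 <= kappa -> 0 < alpha ->
  solution kappa alpha q r <->
  exists2 s, 0 < s & [/\ gap kappa alpha s = 0, q = overlap s & r = s ^+ 2].
Proof.
move=> k0 a0; split; last first.
  move=> [s s0 [g0 qE rE]]; have q0 := overlap_gt0 s0; have q1 := overlap_lt1 s0.
  have sE : Num.sqrt r = s by rewrite rE sqrtr_sqr gtr0_norm.
  split; rewrite ?rE ?sqr_ge0 //; first by rewrite qE q1 ltW.
    by rewrite -rE /P_r sE qE.
  rewrite qE R_kappaE //.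
  have p0 : 0 < 1 - overlap s by rewrite subr_gt0.
  move/eqP: g0; rewrite subr_eq0 -overlap_moment => /eqP <-.
  by field; rewrite gt_eqF.
move=> [/andP[q0 q1] r0 qE rE].
have qs : q = overlap (Num.sqrt r) by [].
have s0 : 0 < Num.sqrt r.
  rewrite lt_neqAle sqrtr_ge0 andbT eq_sym; apply/eqP => sr0.
  have r00 : r = 0 by apply/eqP; rewrite eq_le r0 -sqrtr_eq0 sr0 eqxx.
  have q00 : q = 0 by rewrite qs sr0 overlap0.
  move: rE; rewrite /R_kappa q00 r00.
  rewrite (_ : gaussE _ = F_q kappa 0 0 ^+ 2); last first.
    rewrite -[RHS]gaussE_cst; congr gaussE; apply/funext => z.
    by rewrite sqrtr0 mul0r.
  move/eqP; rewrite eq_sym gt_eqF // mulr_gt0 // exprn_gt0 //.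
  by rewrite mulr_gt0 ?invMills_gt0 // invr_gt0 sqrtr_gt0 subr0.
exists (Num.sqrt r) => //; split => //; last by rewrite sqr_sqrtr.
have p0 : 0 < 1 - overlap (Num.sqrt r) by rewrite subr_gt0 overlap_lt1.
move: rE; rewrite {1}qs R_kappaE // /gap -overlap_moment exprMn sqr_sqrtr // => {1}->.
by rewrite divfK ?subrr // expf_neq0 // gt_eqF.
Qed.

Lemma sqr_norm_moment : (2 * phi 0) ^+ 2 = 2 / pi :> R.
Proof. by rewrite -invMills0 sqr_invMills0. Qed.

Lemma gap_lt kappa alpha s : 0 <= kappa -> 0 <= alpha -> 0 < s ->
  gap kappa alpha s < 2 / pi - alpha * C_kappa kappa.
Proof.
move=> k0 a0 s0; apply: ltr_leB.
  rewrite -sqr_norm_moment ltr_sqr ?nnegrE ?(ltW (tanh_moment_gt0 s0)) //.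
    exact: tanh_moment_lt.
  by rewrite mulr_ge0 // ltW // phi_gt0.
by rewrite ler_wpM2l // energy_ge ?snr_ge0.
Qed.

(** [tanh_moment s <= s], while the energy is at least [C_kappa]. *)
Lemma gap_neg kappa alpha : 0 <= kappa -> 0 < alpha ->
  exists2 s, 0 < s & gap kappa alpha s < 0.
Proof.
move=> k0 a0; have C0 := C_kappa_gt0 k0; have aC := mulr_gt0 a0 C0.
pose s := Num.sqrt (alpha * C_kappa kappa) / 2.
have s0 : 0 < s by rewrite divr_gt0 // sqrtr_gt0.
exists s => //; rewrite subr_lt0.
apply: (@lt_le_trans _ _ (alpha * C_kappa kappa)); last first.
  by rewrite ler_pM2l // energy_ge ?snr_ge0.
apply: (@le_lt_trans _ _ (s ^+ 2)); last first.
  by rewrite exprMn sqr_sqrtr ?(ltW aC) // exprVn; lra.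
rewrite ler_sqr ?nnegrE ?(ltW (tanh_moment_gt0 s0)) ?(ltW s0) //.
by rewrite -overlap_moment ler_piMr ?(ltW s0) //; have := overlap_gt0 s0; lra.
Qed.

(** At [s = n^2] the moment is within [1 / n] of its limit; as
    [1 - overlap s <= 1 / s], the energy is within [K / n] of its own. *)
Lemma gap_pos kappa alpha : 0 <= kappa -> 0 < alpha ->
  alpha * C_kappa kappa < 2 / pi -> exists2 s, 0 < s & 0 < gap kappa alpha s.
Proof.
move=> k0 a0 aC; have [K K0 lim] := energy_limit k0.
pose d := 2 / pi - alpha * C_kappa kappa; have d0 : 0 < d by rewrite subr_gt0.
pose n := 1 + (2 + alpha * K) / d.
have aK := mulr_ge0 (ltW a0) K0.
have n1 : 1 < n by rewrite ltrDl divr_gt0 // ltr_wpDr.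
have n0 : 0 < n by lra.
have nd : 2 + alpha * K < d * n.
  by rewrite /n mulrDr mulrCA divff ?gt_eqF // !mulr1 ltrDr.
have s0 : 0 < n ^+ 2 by rewrite exprn_gt0.
exists (n ^+ 2) => //.
set s := n ^+ 2 in s0 *.
have p1 : 2 * phi 0 <= 1 :> R by rewrite -invMills0 invMills0_le1.
have pg := phi_gt0 (0 : R).
have B := tanh_moment_ge s0; have B0 := tanh_moment_gt0 s0; have B1 := tanh_moment_lt s.
have om : 1 - overlap s <= n^-1 ^+ 2.
  rewrite exprVn -/s -[leRHS]mul1r ler_pdivlMr // mulrC overlap_moment; lra.
have E : energy kappa (snr s) <= C_kappa kappa + K / n.
  have := lim _ (snr_ge0 s); rewrite ler_norml => /andP[_].
  rewrite lerBlDl => /le_trans; apply; rewrite lerD2l ler_wpM2l //.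
  have q1 := overlap_lt1 s0.
  rewrite snr_sqr // sqrtrV ?subr_ge0 ?(ltW q1) // invrK.
  rewrite -[leRHS]ger0_norm ?invr_ge0 ?(ltW n0) // -sqrtr_sqr ler_wsqrtr //.
have sn : s^-1 <= n^-1 by rewrite lef_pV2 ?posrE // /s expr2 ler_pMl //; exact: ltW.
have Bsq : 2 / pi - 2 / n <= tanh_moment s ^+ 2.
  by rewrite -sqr_norm_moment; nra.
rewrite subr_gt0; apply: (@lt_le_trans _ _ (2 / pi - 2 / n)) => //.
apply: (@le_lt_trans _ _ (alpha * (C_kappa kappa + K / n))); first by rewrite ler_pM2l.
have : (2 + alpha * K) / n < d by rewrite ltr_pdivrMr.
by rewrite /d mulrDl mulrDr [alpha * (K / n)]mulrA; lra.
Qed.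

End fixed_point.

Theorem theorem1 (R : realType) (kappa : R) (hkappa : 0 <= kappa) :
  (forall alpha : R, 0 < alpha -> alpha < alpha_c kappa ->
     exists! qr : R * R, solution kappa alpha qr.1 qr.2) /\
  (forall alpha : R, alpha_c kappa <= alpha ->
     ~ exists qr : R * R, solution kappa alpha qr.1 qr.2).
Proof.
have C0 := C_kappa_gt0 hkappa; have pi0 := @pi_gt0 R.
have ac0 : 0 < alpha_c kappa by rewrite divr_gt0 // mulr_gt0.
have acE : alpha_c kappa = 2 / pi / C_kappa kappa by rewrite /alpha_c invfM mulrA.
split=> alpha.
- move=> a0; rewrite acE ltr_pdivlMr // => aC.
  have [s1 s10 g1] := gap_neg hkappa a0.
  have [s2 s20 g2] := gap_pos hkappa a0 aC.
  have s12 : s1 <= s2.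
    rewrite leNgt; apply/negP => s21.
    have := gap_increasing hkappa (ltW a0) s20 s21; lra.
  have [||s sab gs] := @IVT _ (gap kappa alpha) s1 s2 0 s12.
  + apply: continuous_in_subspaceT => x; rewrite inE /= in_itv /= => /andP[s1x _].
    by apply: continuous_gap => //; exact: lt_le_trans s1x.
  + by rewrite ge_min (ltW g1) le_max (ltW g2) orbT.
  have s0 : 0 < s by move: sab; rewrite in_itv /= => /andP[+ _]; exact: lt_le_trans.
  exists (overlap s, s ^+ 2); split.
    by apply/gap_solution => //; exists s.
  move=> [q r] /= /(gap_solution _ _ hkappa a0)[t t0 [gt -> ->]].
  have [st|ts|->//] := ltgtP s t.
  + by have := gap_increasing hkappa (ltW a0) s0 st; rewrite gs gt ltxx.
  + by have := gap_increasing hkappa (ltW a0) t0 ts; rewrite gs gt ltxx.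
- move=> aca; have a0 := lt_le_trans ac0 aca.
  move=> [[q r] /(gap_solution _ _ hkappa a0)[s s0 [gs _ _]]].
  have := gap_lt hkappa (ltW a0) s0; rewrite gs ltNge => /negP; apply.
  by rewrite subr_le0; move: aca; rewrite acE ler_pdivrMr.
Qed.
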